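(* Let $M=\mathbb{R}^3$ or $M=\mathbb{T}^3$, and let $\|\cdot\|_s$ denote the norm of the Sobolev space $H^s(M)$. Let $\Omega$ be a solution of the 3D Euler equation in vorticity form $$\partial_t\Omega+(u\cdot\nabla)\Omega-(\Omega\cdot\nabla)u=0$$ on $M$, where $u$ is the velocity, $\Omega=\nabla\times u$ and $\nabla\cdot u=0$. Let $\lambda$ be a complex constant (independent of $t$ and of the space variables), and let $\phi$ be a complex scalar-valued function with $\phi(t,\cdot)\in H^s(M)$, $\phi(t,\cdot)\ne 0$, solving the Lax pair at $(\Omega,\lambda)$: $$(\Omega\cdot\nabla)\phi=\lambda\phi,\qquad \partial_t\phi+(u\cdot\nabla)\phi=0 .$$ Then the quantity $$I=\frac{\|(\Omega\cdot\nabla)\phi\|_s}{\|\phi\|_s}$$ is a conservation law, i.e. $I$ is independent of $t$.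
   Context: Here $u=(u_1,u_2,u_3)$ is the velocity, $\Omega=(\Omega_1,\Omega_2,\Omega_3)$ is the vorticity, $\nabla=(\partial_x,\partial_y,\partial_z)$, and $t$ is time; $u$ is determined by $\Omega$, for example through the Biot–Savart law. Solutions are understood to be regular enough that all the equations and norms in the statement make sense. *)

(* Defs.v *)
From HB Require Import structures.
From mathcomp Require Import all_boot all_order all_algebra.
From mathcomp Require Import all_classical all_reals all_analysis.
From mathcomp Require Import complex.

Set Implicit Arguments.
Unset Strict Implicit.
Unset Printing Implicit Defensive.

Import Order.TTheory GRing.Theory Num.Theory.
Import numFieldTopology.Exports numFieldNormedType.Exports.

Local Open Scope classical_set_scope.
Local Open Scope ring_scope.
Local Open Scope complex_scope.

Section Calculus.
Context {R : realType}.
Local Notation X := 'rV[R]_3.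
Local Notation Re := (@complex.Re R).
Local Notation Im := (@complex.Im R).

Definition basis (i : 'I_3) : X := delta_mx 0 i.

Definition partial {V : normedModType R} (i : 'I_3) (f : X -> V) (x : X) : V :=
  'D_(basis i) f x.

(* [R[i]] carries no normed-module structure over [R], so complex-valued
   functions are differentiated and integrated componentwise. *)
Definition cpartial (i : 'I_3) (f : X -> R[i]) (x : X) : R[i] :=
  partial i (Re \o f) x +i* partial i (Im \o f) x.

Definition cderive1 (f : R -> R[i]) (t : R) : R[i] :=
  derive1 (Re \o f) t +i* derive1 (Im \o f) t.

Definition advect (v w : X -> X) (x : X) : X :=
  \sum_i v x 0 i *: partial i w x.

Definition cadvect (v : X -> X) (f : X -> R[i]) (x : X) : R[i] :=
  \sum_i (v x 0 i)%:C * cpartial i f x.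

Definition divergence (v : X -> X) (x : X) : R :=
  \sum_i partial i v x 0 i.

(* Indices are elements of the ring 'I_3 of integers mod 3. *)
Definition curl (v : X -> X) (x : X) : X :=
  \row_i (partial (i + 1) v x 0 (i + 2) - partial (i + 2) v x 0 (i + 1)).

Definition dot (x y : X) : R := \sum_i x 0 i * y 0 i.

Definition smooth (f : X -> R) : Prop :=
  forall (l : seq 'I_3) (x : X), differentiable (foldr partial f l) x.

Definition compactly_supported (f : X -> R) : Prop :=
  exists r : R, forall x, r < `|x| -> f x = 0.

End Calculus.

Section Integration.
Context {R : realType}.
Local Notation X := 'rV[R]_3.
Local Notation Re := (@complex.Re R).
Local Notation Im := (@complex.Im R).

Local Notation R3 :=
  (measurableTypeR R * measurableTypeR R * measurableTypeR R)%type.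

Definition leb3 :=
  ((@lebesgue_measure R \x @lebesgue_measure R) \x @lebesgue_measure R)%E.

(* Row vectors have no measurable structure in the library: integrals over R^3
   are taken over R * R * R and transported along this bijection. *)
Definition vec3 (p : R3) : X :=
  \row_i [tuple p.1.1; p.1.2; p.2]`_i.

Definition cmeasurable (f : X -> R[i]) : Prop :=
  measurable_fun [set: R3] (Re \o f \o vec3) /\
  measurable_fun [set: R3] (Im \o f \o vec3).

Definition cintegrable (D : set X) (f : X -> R[i]) : Prop :=
  leb3.-integrable (vec3 @^-1` D) (EFin \o Re \o f \o vec3) /\
  leb3.-integrable (vec3 @^-1` D) (EFin \o Im \o f \o vec3).

Definition cintegral (D : set X) (f : X -> R[i]) : R[i] :=
  (\int[leb3]_(p in vec3 @^-1` D) Re (f (vec3 p))) +i*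
  (\int[leb3]_(p in vec3 @^-1` D) Im (f (vec3 p))).

(* `|x| is the sup norm, so these sets are cubes. *)
Definition clocally_integrable (f : X -> R[i]) : Prop :=
  forall r : R, cintegrable [set x | `|x| <= r] f.

End Integration.

Section Sobolev.
Context {R : realType}.
Local Notation X := 'rV[R]_3.
Local Notation Re := (@complex.Re R).
Local Notation Im := (@complex.Im R).

Definition expi (t : R) : R[i] := cos t +i* sin t.

Definition csqnorm (z : R[i]) : R := Re z ^+ 2 + Im z ^+ 2.

Definition sobolev_weight (s : R) (xi : X) : R := (1 + dot xi xi) `^ s.

(* Without the factor (2 pi)^-3, which is written at the points of use. *)
Definition inverse_transform (psi : X -> R) (xi : X) : R[i] :=
  cintegral setT (fun x => (psi x)%:C * expi (dot xi x)).

(* [g] is the Fourier transform of [f], with the convention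
   f^(xi) = \int f(x) e^{- i xi . x} dx. As an element of H^s need not be
   integrable, this is meant in the sense of distributions: [f] is the inverse
   transform of [g] when tested against C_c^oo functions. Real-valued test
   functions suffice by linearity. *)
Definition is_fourier_transform (f g : X -> R[i]) : Prop :=
  cmeasurable g /\
  forall psi : X -> R, smooth psi -> compactly_supported psi ->
    cintegrable setT (fun xi => g xi * inverse_transform psi xi) /\
    cintegral setT (fun x => f x * (psi x)%:C) =
    ((2 * pi) ^- 3)%:C *
      cintegral setT (fun xi => g xi * inverse_transform psi xi).

Definition weighted_norm (s : R) (g : X -> R[i]) : \bar R :=
  ((((2 * pi) ^- 3)%:E *
    \int[leb3]_p (sobolev_weight s (vec3 p) * csqnorm (g (vec3 p)))%:E)
   `^ 2^-1)%E.

(* For locally integrable [f], at most one [g] (up to a.e. equality) of finite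
   weighted norm is a Fourier transform of [f], so the infimum is just the
   weighted norm of the Fourier transform, and +oo when [f] is not in H^s. *)
Definition sobolev_norm_space (s : R) (f : X -> R[i]) : \bar R :=
  ereal_inf [set weighted_norm s g | g in is_fourier_transform f].

(* Functions on T^3 = (R / 2 pi Z)^3 are functions on R^3 that are
   2 pi-periodic in each variable. *)
Definition periodic {V : Type} (f : X -> V) : Prop :=
  forall (i : 'I_3) (x : X), f (x + (2 * pi) *: basis i) = f x.

Definition cell : set X := [set x | forall i, 0 <= x 0 i < 2 * pi].

Definition frequency (k : 'rV[int]_3) : X := map_mx intr k.

Definition fourier_coef (f : X -> R[i]) (k : 'rV[int]_3) : R[i] :=
  ((2 * pi) ^- 3)%:C *
    cintegral cell (fun x => f x * expi (- dot (frequency k) x)).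

Definition sobolev_norm_torus (s : R) (f : X -> R[i]) : \bar R :=
  ((\esum_(k in [set: 'rV[int]_3])
      (sobolev_weight s (frequency k) * csqnorm (fourier_coef f k))%:E)
   `^ 2^-1)%E.

Inductive domain := Space | Torus.

Definition defined_on (M : domain) {V : Type} (f : X -> V) : Prop :=
  match M with Space => True | Torus => periodic f end.

Definition sobolev_norm (M : domain) (s : R) (f : X -> R[i]) : \bar R :=
  match M with
  | Space => sobolev_norm_space s f
  | Torus => sobolev_norm_torus s f
  end.

Definition in_sobolev (M : domain) (s : R) (f : X -> R[i]) : Prop :=
  [/\ defined_on M f, clocally_integrable f & (sobolev_norm M s f < +oo)%E].

End Sobolev.

Section Euler.
Context {R : realType}.
Local Notation X := 'rV[R]_3.
Local Notation Re := (@complex.Re R).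
Local Notation Im := (@complex.Im R).

(* [J] is the time interval of the solution; it may contain its endpoints.
   Equations with a time derivative hold in the interior of [J], and the
   unknowns are continuous in time up to the endpoints. *)
Record euler_vorticity_solution (M : domain) (J : interval R)
    (u Omega : R -> X -> X) : Prop := EulerVorticitySolution {
  euler_defined : forall t, t \in J ->
    defined_on M (u t) /\ defined_on M (Omega t);
  euler_space_regular : forall t x, t \in J ->
    differentiable (u t) x /\ differentiable (Omega t) x;
  euler_time_continuous : forall x,
    {within [set` J], continuous (Omega ^~ x)};
  euler_time_regular : forall t x, interior [set` J] t ->
    derivable (Omega ^~ x) t 1;
  euler_vorticity : forall t x, t \in J -> Omega t x = curl (u t) x;
  euler_divergence_free : forall t x, t \in J -> divergence (u t) x = 0;
  euler_equation : forall t x, interior [set` J] t ->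
    derive1 (Omega ^~ x) t + advect (u t) (Omega t) x - advect (Omega t) (u t) x = 0
}.

Record lax_pair_solution (M : domain) (J : interval R)
    (u Omega : R -> X -> X) (lambda : R[i]) (phi : R -> X -> R[i]) : Prop :=
  LaxPairSolution {
  lax_defined : forall t, t \in J -> defined_on M (phi t);
  lax_space_regular : forall t x, t \in J ->
    differentiable (Re \o phi t) x /\
    differentiable (Im \o phi t) x;
  lax_time_continuous : forall x,
    {within [set` J], continuous (fun t => Re (phi t x))} /\
    {within [set` J], continuous (fun t => Im (phi t x))};
  lax_time_regular : forall t x, interior [set` J] t ->
    derivable (fun t => Re (phi t x)) t 1 /\
    derivable (fun t => Im (phi t x)) t 1;
  lax_spectral : forall t x, t \in J ->
    cadvect (Omega t) (phi t) x = lambda * phi t x;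
  lax_evolution : forall t x, interior [set` J] t ->
    cderive1 (phi ^~ x) t + cadvect (u t) (phi t) x = 0
}.

Definition lax_quotient (M : domain) (s : R) (Omega : R -> X -> X)
    (phi : R -> X -> R[i]) (t : R) : R :=
  fine (sobolev_norm M s (cadvect (Omega t) (phi t))) /
  fine (sobolev_norm M s (phi t)).

End Euler.

(* Main.v *)
From HB Require Import structures.
Require Import Defs.
From mathcomp Require Import all_boot all_order all_algebra.
From mathcomp Require Import all_classical all_reals all_analysis.
From mathcomp Require Import complex.
From mathcomp Require Import measurable_realfun.
From mathcomp Require Import ring lra.

(** The spectral equation replaces the numerator by the norm of lambda * phi, so
    the quotient is |lambda| as soon as the Sobolev norm is homogeneous and does
    not vanish at phi: in Rocq a quotient with zero denominator is 0, so the
    second point is what keeps the quotient from jumping between 0 and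
    |lambda|. Both points concern a single function f, continuous and not
    identically zero, at a fixed time ([lax_quotientE]).

    Homogeneity ([sobolev_normZ]) is linearity of the integrals that define the
    Fourier transform or the Fourier coefficients. Only the inequality
    |c f| <= |c| |f| is proved directly; the other one follows by applying it
    to the inverse of c.

    On the torus, a norm equal to 0 makes all Fourier coefficients of f vanish,
    so f is orthogonal to all trigonometric polynomials. If f is nonzero at an
    interior point a of the cell, then Re (conj (f a) f) is bounded below by a
    positive constant near a, whereas the powers of a trigonometric polynomial
    that exceeds 1 only near a grow geometrically near a and stay bounded by 1
    elsewhere: their integrals against f cannot all be 0
    ([eq0_of_null_modes]).

    On the space, the norm is an infimum over the Fourier transforms g of f. If
    it is 0, there are such g with arbitrarily small weighted norm. For a smooth
    bump function psi, the integral of f psi is a multiple of the integral of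
    g against the inverse transform of psi, which the weighted Young inequality
    bounds by the weighted norm of g plus a small multiple of a fixed integral;
    the latter is finite because the transform of psi decays faster than any
    power ([inverse_transform_bound]). Hence the integral of f psi is 0 for
    every bump function ([null_pairing]), which is absurd for a narrow bump
    around a point where f is nonzero. The bump functions are products of three
    functions of one variable, so that their smoothness, their integrals and
    the decay of their transforms reduce to dimension one. *)

Set Implicit Arguments.
Unset Strict Implicit.
Unset Printing Implicit Defensive.
Import Order.TTheory GRing.Theory Num.Theory.
Import numFieldTopology.Exports numFieldNormedType.Exports.

Local Open Scope classical_set_scope.
Local Open Scope ring_scope.

(** * Integrals of tensor products over R^3 *)

Section TensorIntegrals.
Context {R : realType}.
Local Notation R3 :=
  (measurableTypeR R * measurableTypeR R * measurableTypeR R)%type.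
Local Notation mu := (@lebesgue_measure R).

(** By Tonelli, the integral of |f g| is a product of two finite integrals. *)
Lemma integrable_tensor d1 d2 (T1 : measurableType d1) (T2 : measurableType d2)
    (m1 : {sigma_finite_measure set T1 -> \bar R})
    (m2 : {sigma_finite_measure set T2 -> \bar R}) (f : T1 -> R) (g : T2 -> R) :
  m1.-integrable setT (EFin \o f) -> m2.-integrable setT (EFin \o g) ->
  (m1 \x m2)%E.-integrable setT (EFin \o (fun p => f p.1 * g p.2)).
Proof.
move=> fi gi.
have mf := measurable_int _ fi.
have mg := measurable_int _ gi.
have mfg : measurable_fun [set: T1 * T2] (EFin \o (fun p => f p.1 * g p.2)).
  apply/measurable_EFinP; apply: measurable_funM.
    by apply: measurableT_comp => //; exact/measurable_EFinP.
  by apply: measurableT_comp => //; exact/measurable_EFinP.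
apply/integrable12ltyP => //=.
under eq_integral.
  move=> x _.
  under eq_integral do rewrite normrM EFinM.
  rewrite ge0_integralZl_EFin //; last first.
    by apply/measurable_EFinP; apply: measurableT_comp => //; exact/measurable_EFinP.
  over.
have /integrableP[_ gl] := gi.
have /integrableP[_ fl] := fi.
rewrite ge0_integralZr //=.
- rewrite lte_mul_pinfty //.
  + exact: integral_ge0.
  + by rewrite ge0_fin_numE //; exact: integral_ge0.
- by apply/measurable_EFinP; apply: measurableT_comp => //; exact/measurable_EFinP.
- exact: integral_ge0.
Qed.

Lemma Rintegral_tensor d1 d2 (T1 : measurableType d1) (T2 : measurableType d2)
    (m1 : {sigma_finite_measure set T1 -> \bar R})
    (m2 : {sigma_finite_measure set T2 -> \bar R}) (f : T1 -> R) (g : T2 -> R) :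
  m1.-integrable setT (EFin \o f) -> m2.-integrable setT (EFin \o g) ->
  \int[(m1 \x m2)%E]_p (f p.1 * g p.2) = \int[m1]_x f x * \int[m2]_x g x.
Proof.
move=> fi gi; rewrite /Rintegral.
have := integral12_prod_meas1 (integrable_tensor fi gi).
rewrite /fubini_F /= => <-.
under eq_integral.
  move=> x _; under eq_integral do rewrite EFinM.
  rewrite integralZl //; over.
rewrite /=.
have gf := integrable_fin_num measurableT gi.
rewrite -(fineK gf) integralZr //.
by rewrite fineM //; exact: integrable_fin_num fi.
Qed.

(** [leb3] unfolds to the product of this measure with Lebesgue measure. It has a
    name in order to carry the sigma-finite structure that Fubini's theorem
    requires of a factor. *)
Definition leb2 : set (measurableTypeR R * measurableTypeR R)%type -> \bar R :=
  (mu \x mu)%E.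

HB.instance Definition _ := Measure.copy leb2 (mu \x mu)%E.

Lemma sigma_finite_leb2 : sigma_finite setT leb2.
Proof.
exists (fun n => `[- n%:R, n%:R]%classic `*` `[- n%:R, n%:R]%classic).
  apply/esym; rewrite -subTset => -[x y] _.
  exists (Num.truncn (Num.max `|x| `|y|)).+1 => //=.
  rewrite !in_itv /= -!ler_norml.
  have := Num.Theory.truncnS_gt (Num.max `|x| `|y|); rewrite gt_max => /andP[hx hy].
  by rewrite !ltW.
move=> n; split; first exact: measurableX.
rewrite /leb2 product_measure1E //= lebesgue_measure_itv /=.
by case: ifP => _; rewrite ?mule0 // -EFinD -EFinM ltry.
Qed.

HB.instance Definition _ :=
  Measure_isSigmaFinite.Build _ _ _ leb2 sigma_finite_leb2.

Definition triple_tensor (a b c : R -> R) (p : R3) : R := a p.1.1 * b p.1.2 * c p.2.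

Lemma integrable_triple_tensor (a b c : R -> R) :
  mu.-integrable setT (EFin \o a) -> mu.-integrable setT (EFin \o b) ->
  mu.-integrable setT (EFin \o c) ->
  leb3.-integrable setT (EFin \o triple_tensor a b c).
Proof.
move=> ai bi ci.
exact: (integrable_tensor (m1 := leb2) (integrable_tensor ai bi) ci).
Qed.

Lemma Rintegral_triple_tensor (a b c : R -> R) :
  mu.-integrable setT (EFin \o a) -> mu.-integrable setT (EFin \o b) ->
  mu.-integrable setT (EFin \o c) ->
  \int[leb3]_p triple_tensor a b c p = \int[mu]_x a x * \int[mu]_x b x * \int[mu]_x c x.
Proof.
move=> ai bi ci.
rewrite -(Rintegral_tensor ai bi).
by rewrite -(Rintegral_tensor (m1 := leb2) (integrable_tensor ai bi) ci).
Qed.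
End TensorIntegrals.

(** * Coordinates, and measurability of continuous functions on R^3 *)

Section Coordinates.
Context {R : realType}.
Local Notation X := 'rV[R]_3.
Local Notation R3 :=
  (measurableTypeR R * measurableTypeR R * measurableTypeR R)%type.

Lemma vec3E (p : R3) :
  (vec3 p 0 0 = p.1.1) * (vec3 p 0 1 = p.1.2) * (vec3 p 0 (1 + 1) = p.2).
Proof. by rewrite /vec3 !mxE. Qed.

(** The last index is written [1 + 1]: with ring constants as indices, goals
    about the three coordinates of a vector can be stated without ordinals. *)
Lemma ord3P (P : 'I_3 -> Prop) : P 0 -> P 1 -> P (1 + 1) -> forall i, P i.
Proof.
move=> P0 P1 P2 [[|[|[|//]]] h].
- by rewrite (_ : Ordinal h = 0) //; exact/val_inj.
- by rewrite (_ : Ordinal h = 1) //; exact/val_inj.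
- by rewrite (_ : Ordinal h = 1 + 1) //; exact/val_inj.
Qed.

Lemma sum3E (V : nmodType) (F : 'I_3 -> V) : \sum_i F i = F 0 + F 1 + F (1 + 1).
Proof.
by rewrite !big_ord_recr big_ord0 /= add0r; congr (F _ + F _ + F _); exact/val_inj.
Qed.

Lemma prod3E (F : 'I_3 -> R) : \prod_i F i = F 0 * F 1 * F (1 + 1).
Proof.
by rewrite !big_ord_recr big_ord0 /= mul1r; congr (F _ * F _ * F _); exact/val_inj.
Qed.

Lemma coord_le_norm (x : X) i : `|x 0 i| <= `|x|.
Proof.
rewrite [leRHS]/Num.Def.normr /= mx_normrE.
exact: (le_bigmax _ (fun ij => `|x ij.1 ij.2|) (0, i)).
Qed.

Lemma norm_lt3 (x : X) e : 0 < e -> (forall i, `|x 0 i| < e) -> `|x| < e.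
Proof.
move=> e0 xe; rewrite [ltLHS]/Num.Def.normr /= mx_normrE.
by apply/bigmax_ltP; split=> // -[i j] _ /=; rewrite ord1.
Qed.

Lemma norm_le3 (x : X) e : (forall i, `|x 0 i| <= e) -> `|x| <= e.
Proof.
move=> xe; rewrite [leLHS]/Num.Def.normr /= mx_normrE.
apply/bigmax_leP; split=> [|[i j] _ /=]; last by rewrite ord1.
exact: le_trans (xe 0).
Qed.

Lemma measurable_fun_coord (i : 'I_3) :
  measurable_fun [set: R3] (fun p : R3 => vec3 p 0 i).
Proof.
move: i; apply: ord3P.
- under eq_fun do rewrite vec3E.
  exact: measurableT_comp.
- under eq_fun do rewrite vec3E.
  exact: measurableT_comp.
- under eq_fun do rewrite vec3E.
  exact: measurable_snd.
Qed.

(** In the sup norm cubes are balls; as products of intervals they are visibly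
    measurable. *)
Definition cube (a : X) (r : R) : set R3 :=
  (ball (a 0 0) r `*` ball (a 0 1) r) `*` ball (a 0 (1 + 1)) r.

Lemma measurable_cube a r : measurable (cube a r).
Proof. by repeat apply: measurableX; exact: measurable_ball. Qed.

Lemma cubeP a r p : cube a r p <-> forall i, `|a 0 i - vec3 p 0 i| < r.
Proof.
split=> [[[/= h0 h1] h2]|h].
  by apply: ord3P; rewrite vec3E.
have h0 := h 0; have h1 := h 1; have h2 := h (1 + 1).
by move: h0 h1 h2; rewrite !vec3E.
Qed.

(** An open set is the union of the countably many cubes with rational centre
    and rational radius that it contains. *)
Lemma measurable_preimage_vec3 (O : set X) : open O ->
  measurable (vec3 @^-1` O : set R3).
Proof.
move=> oO.
pose a (k : rat * rat * rat * rat) : X := vec3 (ratr k.1.1.1, ratr k.1.1.2, ratr k.1.2).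
pose C k := cube (a k) (ratr k.2).
rewrite (_ : _ @^-1` _ = \bigcup_k (if `[<C k `<=` vec3 @^-1` O>] then C k else set0)).
  apply: countable_bigcupT_measurable => // k.
  by case: ifP => // _; exact: measurable_cube.
apply/seteqP; split=> [p /= Op|p [k _]]; last first.
  by case: ifPn => // /asboolP; exact.
have /nbhs_ballP[e /= e0 he] : nbhs (vec3 p) O by exact: open_nbhs_nbhs.
have [r] : exists r : rat, (0 < ratr r :> R) && (ratr r < e / 2).
  have : 0 < e / 2 by rewrite divr_gt0.
  by move=> /rat_in_itvoo[r]; rewrite in_itv /=; exists r.
move=> /andP[r0 re].
have near (x : R) : exists q : rat, `|ratr q - x| < ratr r.
  have : x - ratr r < x + ratr r by rewrite ltrD2l gtrN.
  move=> /rat_in_itvoo[q]; rewrite in_itv /= => /andP[h1 h2]; exists q.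
  by rewrite ltr_norml ltrBrDl h1 /= ltrBlDl.
have [q0 h0] := near p.1.1; have [q1 h1] := near p.1.2; have [q2 h2] := near p.2.
exists (q0, q1, q2, r) => //.
case: ifPn => [_|/asboolP[]].
  by apply/cubeP; apply: ord3P; rewrite /= !vec3E.
move=> z /cubeP hz; apply: he => /=; rewrite mx_norm_ball /ball_ /=.
apply: norm_lt3 => // i.
have hp : `|a (q0, q1, q2, r) 0 i - vec3 p 0 i| < ratr r.
  by move: i; apply: ord3P; rewrite /= !vec3E.
have -> : (vec3 p - vec3 z) 0 i = vec3 p 0 i - vec3 z 0 i by rewrite !mxE.
move: hp (hz i) re => /=; move: (a _ 0 i) (vec3 p 0 i) (vec3 z 0 i) => u v w.
rewrite !ltr_norml => /andP[? ?] /andP[? ?] ?; apply/andP; split; lra.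
Qed.

Lemma continuous_measurable_vec3 (h : X -> R) : continuous h ->
  measurable_fun [set: R3] (h \o vec3).
Proof.
move=> ch; apply: (measurability _ (RGenOpens.measurableE R)) => _ [_ [a [b ->]] <-].
rewrite setTI comp_preimage; apply: measurable_preimage_vec3.
by apply: open_comp => // x _; exact: ch.
Qed.
End Coordinates.

(** * Smooth bump functions of one variable and the decay of their Fourier transforms *)

Section SmoothFunctions.
Context {R : realType}.
Local Notation mu := (@lebesgue_measure R).
Implicit Types (f g : R -> R) (x : R).

(** Carrying the derivative as a witness, rather than iterating [derive1],
    makes closure under sums, products and affine changes of variable a plain
    induction. *)
Fixpoint differentiable_upto (k : nat) f : Prop :=
  if k is k'.+1 then
    exists2 f' : R -> R, forall x, is_derive x 1 f (f' x) & differentiable_upto k' f'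
  else True.

Definition smooth1 f := forall k, differentiable_upto k f.

Lemma differentiable_uptoS k f :
  differentiable_upto k.+1 f -> differentiable_upto k f.
Proof. by elim: k f => [//|k IH] f [f' ff' /IH f'k]; exists f'. Qed.

Lemma differentiable_uptoD k f g : differentiable_upto k f ->
  differentiable_upto k g -> differentiable_upto k (fun x => f x + g x).
Proof.
elim: k f g => [//|k IH] f g [f' df kf] [g' dg kg].
exists (fun x => f' x + g' x); last exact: IH.
by move=> x; exact: is_deriveD.
Qed.

Lemma differentiable_upto_cst k (c : R) : differentiable_upto k (fun=> c).
Proof.
elim: k c => [//|k IH] c; exists (fun=> 0) => // x; exact: is_derive_cst.
Qed.

Lemma differentiable_uptoM k f g : differentiable_upto k f ->
  differentiable_upto k g -> differentiable_upto k (fun x => f x * g x).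
Proof.
elim: k f g => [//|k IH] f g fk gk.
have fk' := differentiable_uptoS fk; have gk' := differentiable_uptoS gk.
case: fk gk => [f' df kf] [g' dg kg].
exists (fun x => f x * g' x + g x * f' x).
  by move=> x; exact: is_deriveM.
by apply: differentiable_uptoD; exact: IH.
Qed.

Lemma is_derive_affine (c d x : R) :
  is_derive x 1 (fun y : R => c * y + d) c.
Proof.
have := is_deriveD (is_deriveZ c (is_derive_id x (1 : R))) (is_derive_cst d x 1).
by rewrite addr0 /GRing.scale /= mulr1.
Qed.

Lemma differentiable_upto_affine k f (c d : R) : differentiable_upto k f ->
  differentiable_upto k (fun x => f (c * x + d)).
Proof.
elim: k f => [//|k IH] f [f' df kf].
exists (fun x => c * f' (c * x + d)); last first.
  by apply: differentiable_uptoM; [exact: differentiable_upto_cst|exact: IH].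
move=> x.
have := is_derive1_comp (g := fun y => c * y + d) (df _) (is_derive_affine c d x).
by rewrite mulrC.
Qed.

Lemma smooth1_derive f : smooth1 f ->
  (forall x, is_derive x 1 f (derive1 f x)) /\ smooth1 (derive1 f).
Proof.
move=> sf; have [f' ff' _] := sf 1%N.
have f'E : derive1 f = f'.
  by apply/funext => x; rewrite derive1E; exact: derive_val.
split=> [x|k]; first by rewrite f'E.
have [g fg gk] := sf k.+1.
rewrite (_ : derive1 f = g) //; apply/funext => x; rewrite derive1E; exact: derive_val.
Qed.

Lemma is_derive_continuous f g : (forall x, is_derive x 1 f (g x)) -> continuous f.
Proof.
move=> dfg x; have := dfg x => dfx.
by apply: differentiable_continuous; apply/derivable1_diffP; exact: ex_derive.
Qed.

Lemma smooth1_continuous f : smooth1 f -> continuous f.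
Proof. by move=> /smooth1_derive[df _]; exact: is_derive_continuous df. Qed.

Lemma smooth1B f g : smooth1 f -> smooth1 g -> smooth1 (fun x => f x - g x).
Proof.
move=> sf sg k; apply: differentiable_uptoD => //.
have := differentiable_uptoM (differentiable_upto_cst k (-1)) (sg k).
by under eq_fun do rewrite mulN1r.
Qed.

(** The derivative of [flat n] is a combination of [flat n.+1] and [flat n.+2],
    so the whole family of functions x^-n exp (- 1 / x) is smooth by a single
    induction; [flat 0] is the classical function that is smooth, positive on
    the right of 0 and zero on its left. *)
Definition flat (n : nat) x : R :=
  if 0 < x then x^-1 ^+ n * expR (- x^-1) else 0.

(** From exp (y / n) >= y / n, raised to the power n. It gives the flatness of
    [flat n] at the origin, with y = 1 / x. *)
Lemma exprn_expRN_le (n : nat) (y : R) : 0 <= y ->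
  y ^+ n * expR (- y) <= n%:R ^+ n.
Proof.
case: n => [|n] y0; first by rewrite !expr0 mul1r -expR0 ler_expR oppr_le0.
have n0 : 0 < n.+1%:R :> R by [].
rewrite expRN -ler_pdivlMr ?invr_gt0 ?expR_gt0 // invrK.
(* y is split as n * (y / n), to compare n-th powers *)
rewrite (_ : y = n.+1%:R * (y / n.+1%:R)); last by rewrite mulrCA mulfV ?mulr1 // gt_eqF.
rewrite exprMn expRM_natl ler_pM2l ?exprn_gt0 //.

apply: lerXn2r; rewrite ?nnegrE ?expR_ge0 ?divr_ge0 //.
by apply: le_trans (expR_ge1Dx _); rewrite lerDr.
Qed.

(** Away from 0 this is calculus. At 0 the difference quotient is at most a
    constant times h, by [exprn_expRN_le] with exponent n + 2. *)
Lemma is_derive_flat n x :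
  is_derive x 1 (flat n) (flat n.+2 x - n%:R * flat n.+1 x).
Proof.
have [x0|x0|->] := ltgtP x 0.
- rewrite /flat ltNge (ltW x0) /= mulr0 subrr.
  apply: (near_eq_is_derive _ (is_derive_cst (0 : R) x 1)).
  near=> y; rewrite ltNge ifF //; apply/negbTE; rewrite negbK.
  by apply/ltW; near: y; exact: lt_nbhsl.
- rewrite /flat x0.
  have xn0 : x != 0 by rewrite gt_eqF.
  have di : is_derive x 1 (fun y : R => y^-1) (- x ^- 2).
    have := @is_deriveV R id x 1 1 xn0 (is_derive_id _ _).
    by rewrite /GRing.scale /= mulr1.
  have dn := is_deriveX n di; rewrite exprfctE in dn.
  have de : is_derive x 1 (fun y : R => expR (- y^-1)) (x ^- 2 * expR (- x^-1)).
    have := @is_derive1_comp R expR (fun y : R => - y^-1) x _ _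
      (is_derive_expR _) (is_deriveN di).
    by rewrite opprK mulrC.
  have dp : is_derive x 1 (fun y => y^-1 ^+ n * expR (- y^-1))
     (x^-1 ^+ n.+2 * expR (- x^-1) - n%:R * (x^-1 ^+ n.+1 * expR (- x^-1))).
    refine (is_derive_eq (is_deriveM dn de) _).
    rewrite /GRing.scale /= -!exprVn.
    case: n dn => [|n] dn; first by rewrite !expr0; ring.
    by rewrite -mulr_natl !exprS; ring.
  apply: (near_eq_is_derive _ dp).
  by near=> y; rewrite ifT //; near: y; exact: lt_nbhsr.
- have flat0 m : flat m 0 = 0 by rewrite /flat ltxx.
  rewrite !flat0 mulr0 subr0.
  have lim0 : h^-1 *: ((flat n \o shift (0 : R)) (h *: 1) - flat n 0) @[h --> 0^'] --> (0 : R).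
    apply/cvgrPdist_le => e e0; near=> h.
    rewrite flat0 subr0 sub0r normrN /= addr0 /GRing.scale /= mulr1 /flat.
    case: ifPn => [h0|_]; last by rewrite mulr0 normr0 ltW.
    have C0 : 0 < n.+2%:R ^+ n.+2 :> R by rewrite exprn_gt0.
    have he : `|h| <= e / n.+2%:R ^+ n.+2.
      by near: h; apply: dnbhs0_le; rewrite divr_gt0.
    have hV0 : 0 <= h^-1 by rewrite invr_ge0 ltW.
    rewrite ger0_norm ?mulr_ge0 ?exprn_ge0 ?expR_ge0 //.
    have hK : h * h^-1 = 1 by rewrite mulfV // gt_eqF.
    rewrite (_ : _ * _ = h * (h^-1 ^+ n.+2 * expR (- h^-1))); last first.
      by rewrite !exprS !mulrA hK mul1r.
    apply: (@le_trans _ _ (h * n.+2%:R ^+ n.+2)).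
      by rewrite ler_wpM2l ?exprn_expRN_le // ltW.
    by rewrite -ler_pdivlMr // (le_trans (ler_norm h)).
  by apply: DeriveDef; [apply/cvg_ex; exists 0|exact: cvg_lim lim0].
Unshelve. all: by end_near. Qed.

Lemma smooth1_flat n : smooth1 (flat n).
Proof.
move=> k; elim: k n => [//|k IH] n.
exists (fun x => flat n.+2 x - n%:R * flat n.+1 x); first exact: is_derive_flat.
apply: differentiable_uptoD => //.
have := differentiable_uptoM (differentiable_upto_cst k (- n%:R)) (IH n.+1).
by under eq_fun do rewrite mulNr.
Qed.

Definition bump1 (a d : R) (x : R) : R := flat 0 (x - (a - d)) * flat 0 (a + d - x).

Lemma smooth1_bump1 a d : smooth1 (bump1 a d).
Proof.
move=> k; apply: differentiable_uptoM.
  have := differentiable_upto_affine 1 (- (a - d)) (@smooth1_flat 0 k).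
  by under eq_fun do rewrite mul1r.
have := differentiable_upto_affine (-1) (a + d) (@smooth1_flat 0 k).
by under eq_fun do rewrite mulN1r addrC.
Qed.

Lemma bump1_gt0 a d x : `|x - a| < d -> 0 < bump1 a d x.
Proof.
rewrite ltr_norml => /andP[h1 h2]; rewrite /bump1 /flat !ifT ?expr0 ?mul1r.
- by rewrite mulr_gt0 ?expR_gt0.
- lra.
- lra.
Qed.

Lemma bump1_eq0 a d x : d <= `|x - a| -> bump1 a d x = 0.
Proof.
rewrite /bump1 /flat; case: ifPn => [h1|_]; last by rewrite mul0r.
case: ifPn => [h2|_]; last by rewrite mulr0.
rewrite leNgt => /negP[]; rewrite ltr_norml; apply/andP; split; lra.
Qed.

Lemma bump1_ge0 a d x : 0 <= bump1 a d x.
Proof.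
have [/bump1_gt0/ltW//|/bump1_eq0->//] := ltP `|x - a| d.
Qed.

(** A form of compact support that keeps track of the radius A, because the
    derivatives of a function vanish outside the same interval. *)
Definition vanishes_outside (A : R) f := forall x, A < `|x| -> f x = 0.

Lemma restrict_vanishes_outside (A : R) f : vanishes_outside A f -> f \_ `[- A, A] = f.
Proof.
move=> f0; apply/funext => x; rewrite patchE; case: ifPn => //.
rewrite notin_setE /= in_itv /= -ler_norml => /negP; rewrite -ltNge => h.
by rewrite f0.
Qed.

Lemma integrable_continuous (A : R) f : continuous f -> vanishes_outside A f ->
  mu.-integrable setT (EFin \o f).
Proof.
move=> cf f0; rewrite -(restrict_vanishes_outside f0) -restrict_EFin.
have mA : measurable (`[- A, A] : set (measurableTypeR R)) by [].
apply: ((integrable_mkcond (mu := mu) (EFin \o f) mA).1).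
apply: continuous_compact_integrable; first exact: segment_compact.
exact: continuous_subspaceT.
Qed.

(** The fundamental theorem of calculus on an interval whose end points lie
    outside the support. *)
Lemma Rintegral_derive_eq0 (A : R) f g : (forall x, is_derive x 1 f (g x)) ->
  continuous g -> vanishes_outside A f -> vanishes_outside A g ->
  \int[mu]_x g x = 0.
Proof.
move=> dfg cg f0 g0.
(* A may be negative; B is positive and lies strictly outside the support *)
pose B := `|A| + 1.
have AB : A < B by rewrite (le_lt_trans (ler_norm A)) // ltrDl.
have B0 : 0 < B by rewrite ltr_wpDl.
have g0' : vanishes_outside B g by move=> x Bx; rewrite g0 // (lt_trans AB).
have cf := is_derive_continuous dfg.
rewrite -(restrict_vanishes_outside g0') -Rintegral_mkcond /Rintegral.
rewrite (@continuous_FTC2 _ _ f).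
- have fB : f B = 0 by rewrite f0 // gtr0_norm.
  have fNB : f (- B) = 0 by rewrite f0 // normrN gtr0_norm.
  by rewrite fB fNB subee.
- by rewrite gtrN.
- exact: continuous_subspaceT.
- split => [x _||]; first exact: ex_derive.
    exact/cvg_at_right_filter/cf.
  exact/cvg_at_left_filter/cf.
- by move=> x _; rewrite derive1E; exact: derive_val.
Qed.

Lemma vanishes_outsideMl A f g : vanishes_outside A f ->
  vanishes_outside A (fun x => f x * g x).
Proof. by move=> f0 x Ax; rewrite f0 // mul0r. Qed.

Lemma vanishes_outside_derive A f : smooth1 f -> vanishes_outside A f ->
  vanishes_outside A (derive1 f).
Proof.
move=> sf f0 x Ax; rewrite derive1E.
have d0 := is_derive_cst (0 : R) x 1.
rewrite (near_eq_derive (g := cst 0)); first exact: derive_val.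
near=> y; rewrite f0 //; near: y.
have := @norm_continuous _ R x => /cvgr_gt; exact.
Unshelve. all: by end_near. Qed.

(** The free phase theta handles the cosine and the sine transform at once, the
    latter being the case theta = - pi / 2. *)
Definition wave (xi theta x : R) : R := cos (xi * x + theta).

Lemma is_derive_wave xi theta x :
  is_derive x 1 (wave xi theta) (- xi * sin (xi * x + theta)).
Proof.
have := is_derive1_comp (g := fun y : R => xi * y + theta) (is_derive_cos _)
  (is_derive_affine xi theta x).
by rewrite mulNr mulrC mulNr -mulrN.
Qed.

Lemma is_derive_sin_wave xi theta x :
  is_derive x 1 (fun y => sin (xi * y + theta)) (xi * wave xi theta x).
Proof.
have := is_derive1_comp (g := fun y : R => xi * y + theta) (is_derive_sin _)
  (is_derive_affine xi theta x).
by rewrite mulrC.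
Qed.

Lemma continuous_wave xi theta : continuous (wave xi theta).
Proof. exact: is_derive_continuous (is_derive_wave xi theta). Qed.

Definition wave_transform f xi theta := \int[mu]_x (f x * wave xi theta x).

Lemma integrable_wave A f xi theta : continuous f -> vanishes_outside A f ->
  mu.-integrable setT (EFin \o (fun x => f x * wave xi theta x)).
Proof.
move=> cf f0; apply: (@integrable_continuous A).
  by move=> x; apply: continuousM; [exact: cf|exact: continuous_wave].
exact: vanishes_outsideMl.
Qed.

(** The operator 1 - d^2/dx^2, which multiplies the Fourier transform by
    1 + xi^2. *)
Definition helmholtz f x := f x - derive1 (derive1 f) x.

Lemma smooth1_helmholtz f : smooth1 f -> smooth1 (helmholtz f).
Proof.
move=> sf; apply: smooth1B => //.
by apply: (smooth1_derive _).2; apply: (smooth1_derive _).2.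
Qed.

Lemma vanishes_outside_helmholtz A f : smooth1 f -> vanishes_outside A f ->
  vanishes_outside A (helmholtz f).
Proof.
move=> sf f0 x Ax; rewrite /helmholtz f0 // sub0r.
have sf' := (smooth1_derive sf).2.
have f'0 := vanishes_outside_derive sf f0.
by rewrite (vanishes_outside_derive sf' f'0) ?oppr0.
Qed.

(** Two integrations by parts, done in one step: the function G below is a
    primitive of f'' wave + xi^2 f wave and vanishes outside the support of
    f. *)
Lemma wave_transform_helmholtz A f xi theta : smooth1 f -> vanishes_outside A f ->
  (1 + xi ^+ 2) * wave_transform f xi theta = wave_transform (helmholtz f) xi theta.
Proof.
move=> sf f0.
have [df sf'] := smooth1_derive sf; have [df' sf''] := smooth1_derive sf'.
have f'0 := vanishes_outside_derive sf f0.
have f''0 := vanishes_outside_derive sf' f'0.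
have cf := smooth1_continuous sf; have cf'' := smooth1_continuous sf''.
have If := integrable_wave xi theta cf f0.
have If'' := integrable_wave xi theta cf'' f''0.
pose G x := derive1 f x * wave xi theta x + f x * (xi * sin (xi * x + theta)).
pose g x := derive1 (derive1 f) x * wave xi theta x + xi ^+ 2 * (f x * wave xi theta x).
have dG x : is_derive x 1 G (g x).
  have h1 := is_deriveM (df' x) (is_derive_wave xi theta x).
  have h2 := is_deriveM (df x) (is_deriveZ xi (is_derive_sin_wave xi theta x)).
  have h := is_deriveD h1 h2.
  refine (is_derive_eq h _).
  by rewrite /g /GRing.scale /= /GRing.scale /=; ring.
have cg : continuous g.
  move=> x; apply: cvgD.
    by apply: continuousM; [exact: cf''|exact: continuous_wave].
  apply: cvgM; first exact: cvg_cst.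
  by apply: continuousM; [exact: cf|exact: continuous_wave].
have := @Rintegral_derive_eq0 A G g dG cg.
rewrite /g RintegralD //; last first.
  have := integrableZl measurableT (xi ^+ 2) If.
  by apply: eq_integrable => // x _; rewrite /= EFinM.
rewrite RintegralZl // -!/(wave_transform _ _ _) => H.
rewrite /wave_transform /helmholtz.
under [RHS]eq_Rintegral do rewrite mulrBl.
rewrite RintegralB // -!/(wave_transform _ _ _) mulrDl mul1r; congr (_ + _).
apply/eqP; rewrite -addr_eq0 addrC; apply/eqP; apply: H.
- by move=> x Ax; rewrite /G f'0 // f0 // !mul0r addr0.
- by move=> x Ax; rewrite f''0 // f0 // !mul0r mulr0 addr0.
Qed.

(** Each application of [helmholtz] gains a factor 1 + xi^2, and a transform is
    at most the L^1 norm of the function. *)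
Lemma wave_transform_decay A k f : smooth1 f -> vanishes_outside A f ->
  exists C, forall xi theta, (1 + xi ^+ 2) ^+ k * `|wave_transform f xi theta| <= C.
Proof.
elim: k f => [|k IH] f sf f0.
  exists (\int[mu]_x `|f x|) => xi theta; rewrite expr0 mul1r.
  have cf := smooth1_continuous sf.
  have If := integrable_wave xi theta cf f0.
  apply: le_trans (le_normr_Rintegral _ If) _ => //.
  apply: le_Rintegral => //.
  - exact: integrable_norm.
  - by apply: integrable_norm; exact: integrable_continuous cf f0.
  - move=> x _; rewrite normrM ler_piMr //.
    by rewrite /wave ler_norml cos_le1 cos_geN1.
have [C HC] := IH _ (smooth1_helmholtz sf) (vanishes_outside_helmholtz sf f0).
exists C => xi theta; have := HC xi theta.
rewrite -(wave_transform_helmholtz _ _ sf f0) normrM (exprSr (1 + xi ^+ 2)) mulrA.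
by rewrite (ger0_norm (addr_ge0 ler01 (sqr_ge0 xi))).
Qed.
End SmoothFunctions.

(** * Linearity of the complex integral *)

Section ComplexIntegrals.
Context {R : realType}.
Local Notation X := 'rV[R]_3.
Local Notation R3 :=
  (measurableTypeR R * measurableTypeR R * measurableTypeR R)%type.
Local Notation Re := (@complex.Re R).
Local Notation Im := (@complex.Im R).
Local Open Scope complex_scope.
Implicit Types (f g : X -> R[i]) (D : set X) (c : R[i]).

Lemma complexReM (x y : R[i]) : Re (x * y) = Re x * Re y - Im x * Im y.
Proof. by case: x; case: y. Qed.

Lemma complexImM (x y : R[i]) : Im (x * y) = Re x * Im y + Im x * Re y.
Proof. by case: x; case: y. Qed.

Lemma complexReD (x y : R[i]) : Re (x + y) = Re x + Re y.
Proof. by case: x; case: y. Qed.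

Lemma complexImD (x y : R[i]) : Im (x + y) = Im x + Im y.
Proof. by case: x; case: y. Qed.

Lemma complex_ext (x y : R[i]) : Re x = Re y -> Im x = Im y -> x = y.
Proof. by case: x; case: y => /= ? ? ? ? -> ->. Qed.

Notation measurable_vec3 D := (measurable (vec3 @^-1` D : set R3)).

Lemma integrableZ_EFin (D : set R3) (r : R) (h : R3 -> R) : measurable D ->
  leb3.-integrable D (EFin \o h) ->
  leb3.-integrable D (EFin \o (fun p => r * h p)).
Proof.
move=> mD hi; apply: eq_integrable (integrableZl mD r hi) => //.
Qed.

Lemma integrableD_EFin (D : set R3) (h1 h2 : R3 -> R) : measurable D ->
  leb3.-integrable D (EFin \o h1) -> leb3.-integrable D (EFin \o h2) ->
  leb3.-integrable D (EFin \o (fun p => h1 p + h2 p)).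
Proof.
move=> mD hi1 hi2; apply: eq_integrable (integrableD mD hi1 hi2) => //.
Qed.

Lemma integrableB_EFin (D : set R3) (h1 h2 : R3 -> R) : measurable D ->
  leb3.-integrable D (EFin \o h1) -> leb3.-integrable D (EFin \o h2) ->
  leb3.-integrable D (EFin \o (fun p => h1 p - h2 p)).
Proof.
move=> mD hi1 hi2; apply: eq_integrable (integrableB mD hi1 hi2) => //.
Qed.

Lemma integrableM_EFin (D : set R3) (M : R) (h k : R3 -> R) : measurable D ->
  leb3.-integrable D (EFin \o h) -> measurable_fun D k ->
  (forall p, D p -> `|k p| <= M) ->
  leb3.-integrable D (EFin \o (fun p => h p * k p)).
Proof.
move=> mD hi mk kM.
have bk : [bounded k p | p in D].
  exists M; split; first exact: num_real.
  by move=> N MN p Dp; exact: le_trans (kM _ Dp) (ltW MN).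
apply: eq_integrable (integrableMr mD mk bk hi) => // p _.
by rewrite /= EFinM muleC.
Qed.

Lemma cintegrableZ D c f : measurable_vec3 D -> cintegrable D f ->
  cintegrable D (fun x => c * f x).
Proof.
move=> mD [fr fi]; split.
  apply: eq_integrable (integrableB_EFin mD
    (integrableZ_EFin (Re c) mD fr) (integrableZ_EFin (Im c) mD fi)) => // p _.
  by rewrite /= complexReM.
apply: eq_integrable (integrableD_EFin mD
  (integrableZ_EFin (Re c) mD fi) (integrableZ_EFin (Im c) mD fr)) => // p _.
by rewrite /= complexImM.
Qed.

Lemma cintegralZ D c f : measurable_vec3 D -> cintegrable D f ->
  cintegral D (fun x => c * f x) = c * cintegral D f.
Proof.
move=> mD [fr fi]; apply: complex_ext.
  rewrite complexReM /cintegral /= -!RintegralZl // -RintegralB //;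
    try exact: integrableZ_EFin.
  by apply: eq_Rintegral => p _; rewrite complexReM.
rewrite complexImM /cintegral /= -!RintegralZl // -RintegralD //;
  try exact: integrableZ_EFin.
by apply: eq_Rintegral => p _; rewrite complexImM.
Qed.

Lemma cintegrableD D f g : measurable_vec3 D -> cintegrable D f ->
  cintegrable D g -> cintegrable D (fun x => f x + g x).
Proof.
move=> mD [fr fi] [gr gi]; split.
  apply: eq_integrable (integrableD_EFin mD fr gr) => // p _.
  by rewrite /= complexReD.
apply: eq_integrable (integrableD_EFin mD fi gi) => // p _.
by rewrite /= complexImD.
Qed.

Lemma cintegralD D f g : measurable_vec3 D -> cintegrable D f ->
  cintegrable D g ->
  cintegral D (fun x => f x + g x) = cintegral D f + cintegral D g.
Proof.
move=> mD [fr fi] [gr gi]; apply: complex_ext.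
  rewrite complexReD /cintegral /= -RintegralD //.
  by apply: eq_Rintegral => p _; rewrite complexReD.
rewrite complexImD /cintegral /= -RintegralD //.
by apply: eq_Rintegral => p _; rewrite complexImD.
Qed.

Lemma cintegrableM D (M : R) f h : measurable_vec3 D -> cintegrable D f ->
  cmeasurable h -> (forall x, D x -> `|Re (h x)| <= M /\ `|Im (h x)| <= M) ->
  cintegrable D (fun x => f x * h x).
Proof.
move=> mD [fr fi] [mhr mhi] hM.
have mr : measurable_fun (vec3 @^-1` D) (Re \o h \o vec3) by exact: measurable_funTS.
have mi : measurable_fun (vec3 @^-1` D) (Im \o h \o vec3) by exact: measurable_funTS.
have bR p : (vec3 @^-1` D) p -> `|(Re \o h \o vec3) p| <= M by move=> /hM[].
have bI p : (vec3 @^-1` D) p -> `|(Im \o h \o vec3) p| <= M by move=> /hM[].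
split.
  apply: eq_integrable (integrableB_EFin mD (integrableM_EFin mD fr mr bR)
    (integrableM_EFin mD fi mi bI)) => // p _.
  by rewrite /= complexReM.
apply: eq_integrable (integrableD_EFin mD (integrableM_EFin mD fr mi bI)
    (integrableM_EFin mD fi mr bR)) => // p _.
by rewrite /= complexImM.
Qed.

Lemma cintegrableS D D' f : measurable_vec3 D -> measurable_vec3 D' ->
  D `<=` D' -> cintegrable D' f -> cintegrable D f.
Proof.
move=> mD mD' DD' [fr fi].
have DD : vec3 @^-1` D `<=` (vec3 @^-1` D' : set R3) by move=> p; exact: DD'.
by split; [exact: (integrableS mD' mD DD fr)|exact: (integrableS mD' mD DD fi)].
Qed.

Lemma cintegrable_setT D f : measurable_vec3 D -> cintegrable D f ->
  (forall x, ~ D x -> f x = 0) -> cintegrable setT f.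
Proof.
move=> mD [fr fi] f0; split.
- have := (integrable_mkcond _ mD).1 fr; apply: eq_integrable => // p _.
  by rewrite patchE /=; case: ifPn => //; rewrite notin_setE => /f0 /= ->.
- have := (integrable_mkcond _ mD).1 fi; apply: eq_integrable => // p _.
  by rewrite patchE /=; case: ifPn => //; rewrite notin_setE => /f0 /= ->.
Qed.

(** Both cubes and the period cell are of this form. *)
Lemma measurable_all_coords (A : set (measurableTypeR R)) : measurable A ->
  measurable_vec3 [set x | forall i, A (x 0 i)].
Proof.
move=> mA.
have mi i : measurable ((fun p : R3 => vec3 p 0 i) @^-1` A).
  rewrite -[X in measurable X]setTI.
  exact: measurable_fun_coord.
rewrite (_ : _ @^-1` _ = \bigcap_(i in [set: 'I_3]) ((fun p : R3 => vec3 p 0 i) @^-1` A)).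
  by apply: fin_bigcap_measurable => //; exact: finite_finset.
by apply/seteqP; split=> p /= h i; [move=> _; exact: h|exact: h].
Qed.

Lemma measurable_cballs (r : R) : measurable_vec3 [set x : X | `|x| <= r].
Proof.
rewrite (_ : [set x | _] = [set x : X | forall i, `[- r, r]%classic (x 0 i)]).
  exact: measurable_all_coords.
apply/seteqP; split=> x /= h.
  by move=> i; rewrite in_itv /= -ler_norml; exact: le_trans (coord_le_norm x i) h.
by apply: norm_le3 => i; have := h i; rewrite in_itv /= -ler_norml.
Qed.

Lemma measurable_cell : measurable_vec3 (@cell R).
Proof.
rewrite (_ : cell = [set x : X | forall i, `[0, 2 * pi[%classic (x 0 i)]).
  exact: measurable_all_coords.
by apply/seteqP; split=> x /= h i; have := h i; rewrite in_itv.
Qed.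

Lemma continuous_bounded_cballs (h : X -> R) (r : R) : continuous h ->
  exists M, forall x, `|x| <= r -> `|h x| <= M.
Proof.
move=> ch.
have cB : compact [set x : X | `|x| <= r].
  apply: bounded_closed_compact.
    exists r; split; first exact: num_real.
    by move=> N rN x /= /le_trans; apply; exact: ltW.
  have -> : [set x : X | `|x| <= r] = closed_ball_ Num.norm 0 r.
    by apply/seteqP; split=> x; rewrite /closed_ball_ /= sub0r normrN.
  exact: closed_closed_ball_.
have := continuous_compact (continuous_subspaceT ch) cB.
move=> /compact_bounded[M [_ hM]].
exists (M + 1) => x xr; apply: (hM (M + 1)); first by rewrite ltrDl.
by exists x.
Qed.
End ComplexIntegrals.

(** * Homogeneity of the Sobolev norms *)

Section Homogeneity.
Context {R : realType}.
Local Notation X := 'rV[R]_3.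
Local Notation R3 :=
  (measurableTypeR R * measurableTypeR R * measurableTypeR R)%type.
Local Notation Re := (@complex.Re R).
Local Notation Im := (@complex.Im R).
Local Open Scope complex_scope.
Implicit Types (f g : X -> R[i]) (D : set X) (c : R[i]) (psi : X -> R).

Definition cabs c : R := Num.sqrt (csqnorm c).

Lemma csqnorm_ge0 c : 0 <= csqnorm c.
Proof. by rewrite addr_ge0 ?sqr_ge0. Qed.

Lemma csqnormM c z : csqnorm (c * z) = csqnorm c * csqnorm z.
Proof. by rewrite /csqnorm complexReM complexImM; ring. Qed.

Lemma csqnorm_eq0 c : csqnorm c = 0 -> c = 0.
Proof.
move=> /eqP; rewrite paddr_eq0 ?sqr_ge0 // !sqrf_eq0 => /andP[/eqP h1 /eqP h2].
exact: complex_ext.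
Qed.

Lemma cabs_eq0 c : cabs c = 0 -> c = 0.
Proof.
move=> c0; apply: csqnorm_eq0.
by rewrite -(sqr_sqrtr (csqnorm_ge0 c)) -/(cabs c) c0 expr0n.
Qed.

Lemma cabsV c : c != 0 -> cabs c^-1 * cabs c = 1.
Proof.
move=> c0; rewrite -sqrtrM ?csqnorm_ge0 // -csqnormM mulVf //.
by rewrite /csqnorm /= expr1n expr0n addr0 sqrtr1.
Qed.

Lemma poweR_csqnorm c : (((csqnorm c)%:E `^ 2^-1) = (cabs c)%:E)%E.
Proof. by rewrite poweR_EFin powR12_sqrt ?csqnorm_ge0. Qed.

Lemma cmeasurableZ c g : cmeasurable g -> cmeasurable (fun x => c * g x).
Proof.
move=> [mr mi]; split.
  rewrite (_ : _ \o _ = fun p => Re c * (Re \o g \o vec3) p - Im c * (Im \o g \o vec3) p).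
    by apply: measurable_funB; apply: measurable_funM.
  by apply/funext => p; rewrite /= complexReM.
rewrite (_ : _ \o _ = fun p => Re c * (Im \o g \o vec3) p + Im c * (Re \o g \o vec3) p).
  by apply: measurable_funD; apply: measurable_funM.
by apply/funext => p; rewrite /= complexImM.
Qed.

Lemma sobolev_weight_ge0 s (x : X) : 0 <= sobolev_weight s x.
Proof. exact: powR_ge0. Qed.

Lemma dotE (x y : X) :
  dot x y = x 0 0 * y 0 0 + x 0 1 * y 0 1 + x 0 (1 + 1) * y 0 (1 + 1).
Proof. by rewrite /dot sum3E. Qed.

Lemma dot_ge0 (x : X) : 0 <= dot x x.
Proof. by rewrite dotE !addr_ge0 // -expr2 sqr_ge0. Qed.

Lemma sobolev_weight_gt0 s (x : X) : 0 < sobolev_weight s x.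
Proof. by apply: powR_gt0; rewrite ltr_wpDr ?dot_ge0. Qed.

Lemma measurable_weight s :
  measurable_fun [set: R3] (fun p => sobolev_weight s (vec3 p)).
Proof.
apply: (measurableT_comp (measurable_powR s)).
under eq_fun do rewrite dotE.
by repeat (apply: measurable_funD || apply: measurable_funM) => //;
   exact: measurable_fun_coord.
Qed.

Lemma measurable_weighted s g : cmeasurable g ->
  measurable_fun [set: R3]
    (fun p => (sobolev_weight s (vec3 p) * csqnorm (g (vec3 p)))%:E).
Proof.
move=> [mr mi]; apply/measurable_EFinP; apply: measurable_funM.
  exact: measurable_weight.
by apply: measurable_funD; apply: measurable_funX.
Qed.

Lemma weighted_ge0 s g (p : R3) :
  (0 <= (sobolev_weight s (vec3 p) * csqnorm (g (vec3 p)))%:E)%E.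
Proof. by rewrite lee_fin mulr_ge0 ?sobolev_weight_ge0 ?csqnorm_ge0. Qed.

Lemma twopiV_gt0 : 0 < (2 * pi) ^- 3 :> R.
Proof. by rewrite invr_gt0 exprn_gt0 // mulr_gt0 // pi_gt0. Qed.

Lemma weighted_normZ s c g : cmeasurable g ->
  weighted_norm s (fun x => c * g x) = ((cabs c)%:E * weighted_norm s g)%E.
Proof.
move=> mg; rewrite /weighted_norm.
under eq_integral do rewrite csqnormM mulrCA EFinM.
rewrite ge0_integralZl_EFin ?csqnorm_ge0 //.
- rewrite muleCA [LHS]poweRM ?poweR_csqnorm // ?lee_fin ?csqnorm_ge0 //.
  apply: mule_ge0; first by rewrite lee_fin ltW // twopiV_gt0.
  by apply: integral_ge0 => p _; exact: weighted_ge0.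
- by move=> p _; exact: weighted_ge0.
- exact: measurable_weighted.
Qed.

Lemma smooth_continuous psi : smooth psi -> continuous psi.
Proof. by move=> sp x; apply: differentiable_continuous; exact: (sp [::]). Qed.

Lemma cmeasurable_real psi : continuous psi -> cmeasurable (fun x => (psi x)%:C).
Proof.
move=> cpsi; split; first exact: continuous_measurable_vec3.
by rewrite (_ : _ \o _ = cst 0).
Qed.

Lemma cintegrable_test f psi : clocally_integrable f -> continuous psi ->
  compactly_supported psi -> cintegrable setT (fun x => f x * (psi x)%:C).
Proof.
move=> lf cpsi [r psi0].
have [M HM] := continuous_bounded_cballs r cpsi.
apply: (cintegrable_setT (measurable_cballs r)).
  apply: (cintegrableM (M := M) (measurable_cballs r) (lf r) (cmeasurable_real cpsi)).
  move=> x /= xr; rewrite normr0; have := HM _ xr; split=> //.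
  exact: le_trans (HM _ xr).
move=> x /= /negP; rewrite -ltNge => /psi0 ->; exact: mulr0.
Qed.

Lemma is_fourier_transformZ c f g : clocally_integrable f ->
  is_fourier_transform f g ->
  is_fourier_transform (fun x => c * f x) (fun x => c * g x).
Proof.
move=> lf [mg fg]; split; first exact: cmeasurableZ.
move=> psi spsi kpsi; have [ig eg] := fg psi spsi kpsi.
have mT : measurable (vec3 @^-1` [set: X] : set R3) by rewrite preimage_setT.
have ifp := cintegrable_test lf (smooth_continuous spsi) kpsi.
split.
  by under eq_fun do rewrite -mulrA; exact: cintegrableZ.
under eq_fun do rewrite -mulrA.
under [in RHS]eq_fun do rewrite -mulrA.
by rewrite !cintegralZ // eg mulrCA.
Qed.

Lemma clocally_integrableZ c f : clocally_integrable f ->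
  clocally_integrable (fun x => c * f x).
Proof. by move=> lf r; apply: cintegrableZ (lf r); exact: measurable_cballs. Qed.

Lemma sobolev_norm_space_ge0 s f : (0 <= sobolev_norm_space s f)%E.
Proof. by apply: le_ereal_inf_tmp => _ [g _ <-]; exact: poweR_ge0. Qed.

(** Multiplication by c maps the Fourier transforms of f to Fourier transforms
    of c f. Finiteness of the norm matters for c = 0: it provides a transform
    of f, and hence the transform 0 of the zero function. *)
Lemma sobolev_norm_spaceZ_le s c f : clocally_integrable f ->
  (sobolev_norm_space s f < +oo)%E ->
  (sobolev_norm_space s (fun x => (c * f x)%R) <= (cabs c)%:E * sobolev_norm_space s f)%E.
Proof.
move=> lf fy.
have le g : is_fourier_transform f g ->
    (sobolev_norm_space s (fun x => (c * f x)%R) <= (cabs c)%:E * weighted_norm s g)%E.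
  move=> fg; rewrite -weighted_normZ; last by case: fg.
  apply: ereal_inf_lbound; exists (fun x => c * g x) => //.
  exact: is_fourier_transformZ.
have [c0|c0] := eqVneq (cabs c) 0.
  rewrite c0 mul0e.
  have /ereal_inf_lt[_ [g fg <-] _] := fy.
  by have := le g fg; rewrite c0 mul0e.
have cgt : 0 < cabs c by rewrite lt_neqAle eq_sym c0 sqrtr_ge0.
rewrite -lee_pdivrMl //.
apply: le_ereal_inf_tmp => _ [g fg <-].
by rewrite lee_pdivrMl //; exact: le.
Qed.

Lemma cell_le (x : X) : cell x -> `|x| <= 2 * pi.
Proof.
move=> cx; apply: norm_le3 => i; have /andP[x0 x1] := cx i.
by rewrite ger0_norm // ltW.
Qed.

Lemma cintegrable_cell f : clocally_integrable f -> cintegrable cell f.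
Proof.
move=> lf; apply: cintegrableS (lf (2 * pi)) => //.
- exact: measurable_cell.
- exact: measurable_cballs.
- exact: cell_le.
Qed.

Lemma continuous_dot (k : X) : continuous (fun x : X => dot k x).
Proof.
under eq_fun do rewrite dotE.
have ck i : continuous (fun x : X => k 0 i * x 0 i).
  by move=> x; apply: continuousM; [exact: cst_continuous|exact: coord_continuous].
by move=> x; exact: cvgD (cvgD (ck 0 x) (ck 1 x)) (ck (1 + 1) x).
Qed.

Lemma cmeasurable_expi (k : X) : cmeasurable (fun x => expi (- dot k x)).
Proof.
split; rewrite /comp /=.
  apply: (@continuous_measurable_vec3 _ (fun x => cos (- dot k x))) => x.
  apply: (@continuous_comp _ _ _ (fun x => - dot k x) cos); last exact: continuous_cos.
  by apply: continuousN; exact: continuous_dot.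
apply: (@continuous_measurable_vec3 _ (fun x => sin (- dot k x))) => x.
apply: (@continuous_comp _ _ _ (fun x => - dot k x) sin); last exact: continuous_sin.
by apply: continuousN; exact: continuous_dot.
Qed.

Lemma cintegrable_mode f (k : X) : clocally_integrable f ->
  cintegrable cell (fun x => f x * expi (- dot k x)).
Proof.
move=> lf; apply: (cintegrableM (M := 1)).
- exact: measurable_cell.
- exact: cintegrable_cell.
- exact: cmeasurable_expi.
- by move=> x _ /=; rewrite !ler_norml cos_geN1 cos_le1 sin_geN1 sin_le1.
Qed.

Lemma fourier_coefZ c f k : clocally_integrable f ->
  fourier_coef (fun x => c * f x) k = c * fourier_coef f k.
Proof.
move=> lf; rewrite /fourier_coef.
under eq_fun do rewrite -mulrA.
rewrite cintegralZ; last 2 first.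
- exact: measurable_cell.
- exact: cintegrable_mode.
exact: mulrCA.
Qed.

Lemma sobolev_norm_torus_ge0 s f : (0 <= sobolev_norm_torus s f)%E.
Proof. exact: poweR_ge0. Qed.

Lemma sobolev_norm_torusZ_le s c f : clocally_integrable f ->
  (sobolev_norm_torus s (fun x => (c * f x)%R) <= (cabs c)%:E * sobolev_norm_torus s f)%E.
Proof.
move=> lf; rewrite /sobolev_norm_torus.
have c0 : (0 <= (csqnorm c)%:E)%E by rewrite lee_fin csqnorm_ge0.
have w0 g k : (0 <= (sobolev_weight s (frequency k) * csqnorm (fourier_coef g k))%:E)%E.
  by rewrite lee_fin mulr_ge0 ?sobolev_weight_ge0 ?csqnorm_ge0.
have sum0 g : (0 <= \esum_(k in [set: 'rV[int]_3])
    (sobolev_weight s (frequency k) * csqnorm (fourier_coef g k))%:E)%E.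
  by apply: esum_ge0 => k _.
rewrite -poweR_csqnorm -(poweRM 2^-1 c0 (sum0 f)).
apply: gt0_ler_poweR; rewrite ?in_itv /= ?leey ?andbT ?invr_ge0 ?ler0n //.
  exact: mule_ge0.
apply: ge_ereal_sup => _ [A fA <-].
under eq_fsbigr do rewrite fourier_coefZ // csqnormM mulrCA EFinM.
rewrite -ge0_mule_fsumr; last by move=> k; exact: w0.
apply: lee_pmul => //; first exact: fsume_ge0.
by apply: ereal_sup_ubound; exists A.
Qed.

Lemma sobolev_norm_ge0 M s f : (0 <= sobolev_norm M s f)%E.
Proof. by case: M => /=; [exact: sobolev_norm_space_ge0|exact: sobolev_norm_torus_ge0]. Qed.

Lemma sobolev_normZ_le M s c f : clocally_integrable f ->
  (sobolev_norm M s f < +oo)%E ->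
  (sobolev_norm M s (fun x => (c * f x)%R) <= (cabs c)%:E * sobolev_norm M s f)%E.
Proof.
case: M => /= lf fy; first exact: sobolev_norm_spaceZ_le.
exact: sobolev_norm_torusZ_le.
Qed.

(** The inequality for c, together with the inequality for the inverse of c
    applied to c f. *)
Lemma sobolev_normZ M s c f : clocally_integrable f ->
  (sobolev_norm M s f < +oo)%E ->
  sobolev_norm M s (fun x => c * f x) = ((cabs c)%:E * sobolev_norm M s f)%E.
Proof.
move=> lf fy; apply/eqP; rewrite eq_le sobolev_normZ_le //=.
have [->|c0] := eqVneq c 0.
  by rewrite {1}/cabs /csqnorm /= expr0n addr0 sqrtr0 mul0e sobolev_norm_ge0.
have cy : (sobolev_norm M s (fun x => (c * f x)%R) < +oo)%E.
  apply: le_lt_trans (sobolev_normZ_le c lf fy) _.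
  by rewrite lte_mul_pinfty // lee_fin sqrtr_ge0.
have := sobolev_normZ_le c^-1 (clocally_integrableZ c lf) cy.
rewrite (_ : (fun x => c^-1 * (c * f x)) = f); last by apply/funext => x; rewrite mulKf.
have cgt : 0 < cabs c.
  by rewrite lt_neqAle sqrtr_ge0 andbT eq_sym; apply/eqP => /cabs_eq0 /eqP; apply/negP.
move=> h.
apply: le_trans (lee_wpmul2l _ h) _; first by rewrite lee_fin ltW.
by rewrite muleA -EFinM mulrC cabsV // mul1e.
Qed.
End Homogeneity.

(** * Smooth bump functions on R^3 *)

Section TestFunctions.
Context {R : realType}.
Local Notation X := 'rV[R]_3.
Local Notation R3 :=
  (measurableTypeR R * measurableTypeR R * measurableTypeR R)%type.
Local Notation mu := (@lebesgue_measure R).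

Definition tensor (F : 'I_3 -> R -> R) (x : X) : R := \prod_i F i (x 0 i).

Lemma tensorE F x :
  tensor F x = F 0 (x 0 0) * F 1 (x 0 1) * F (1 + 1) (x 0 (1 + 1)).
Proof. exact: prod3E. Qed.

Lemma differentiable_tensor F (x : X) : (forall i, smooth1 (F i)) ->
  differentiable (tensor F) x.
Proof.
move=> sF.
have dF i : differentiable (fun y : X => F i (y 0 i)) x.
  apply: (@differentiable_comp _ _ _ _ (fun y : X => y 0 i) (F i)).
    exact: differentiable_coord.
  by apply/derivable1_diffP; have := (smooth1_derive (sF i)).1 (x 0 i) => ?; exact: ex_derive.
rewrite (_ : tensor F = (fun y => F 0 (y 0 0)) * (fun y => F 1 (y 0 1)) *
    (fun y => F (1 + 1) (y 0 (1 + 1)))).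
  by apply: differentiableM => //; exact: differentiableM.
by apply/funext => y; rewrite tensorE.
Qed.

(** Along a basis vector the difference quotient is the one-variable difference
    quotient if the directions agree, and 0 otherwise. *)
Lemma is_derive_coord_comp (f : R -> R) (x : X) (i j : 'I_3) (df : R) :
  is_derive (x 0 i) 1 f df ->
  is_derive x (Defs.basis j) (fun y : X => f (y 0 i)) ((i == j)%:R * df).
Proof.
move=> dfi; case: eqVneq => [<-|ij].
  have E : (fun h : R => h^-1 *: (((fun y : X => f (y 0 i)) \o shift x) (h *: Defs.basis i) -
      f (x 0 i)))
         = (fun h : R => h^-1 *: ((f \o shift (x 0 i)) (h *: 1) - f (x 0 i))).
    by apply/funext => h; rewrite /= /Defs.basis !mxE !eqxx.
  apply: DeriveDef.
    by rewrite /derivable E; exact: ex_derive.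
  by rewrite /derive E mul1r; exact: derive_val.
rewrite mul0r.
have E : (fun h : R => h^-1 *: (((fun y : X => f (y 0 i)) \o shift x) (h *: Defs.basis j) -
      f (x 0 i)))
         = cst 0.
  apply/funext => h; rewrite /= /Defs.basis !mxE (negbTE ij) /=.
  by rewrite mulr0 add0r subrr scaler0.
apply: DeriveDef; first by rewrite /derivable E; exact: is_cvg_cst.
by rewrite /derive E; exact: lim_cst.
Qed.

(** The partial derivative of a product of one-variable functions is again such
    a product, so smoothness is an induction on the list of directions. *)
Definition derive_factor (F : 'I_3 -> R -> R) (j : 'I_3) : 'I_3 -> R -> R :=
  fun i => if i == j then derive1 (F i) else F i.

Lemma smooth1_derive_factor F j : (forall i, smooth1 (F i)) ->
  forall i, smooth1 (derive_factor F j i).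
Proof.
by move=> sF i; rewrite /derive_factor; case: ifP => // _; exact: (smooth1_derive (sF i)).2.
Qed.

Lemma partial_tensor F j : (forall i, smooth1 (F i)) ->
  partial j (tensor F) = tensor (derive_factor F j).
Proof.
move=> sF; apply/funext => x; rewrite /partial.
have d i := is_derive_coord_comp j ((smooth1_derive (sF i)).1 (x 0 i)).
have h := is_deriveM (is_deriveM (d 0) (d 1)) (d (1 + 1)).
rewrite (_ : tensor F = (fun y => F 0 (y 0 0)) * (fun y => F 1 (y 0 1)) *
    (fun y => F (1 + 1) (y 0 (1 + 1)))); last first.
  by apply/funext => y; rewrite tensorE.
rewrite (@derive_val _ _ _ _ _ _ _ h) tensorE /derive_factor /GRing.scale /= ?fctE.
move: j {d h}; apply: ord3P => /=; ring.
Qed.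

Lemma smooth_tensor F : (forall i, smooth1 (F i)) -> smooth (tensor F).
Proof.
move=> sF l x.
suff [G sG ->] : exists2 G, (forall i, smooth1 (G i)) & foldr partial (tensor F) l = tensor G.
  exact: differentiable_tensor.
elim: l => [|j l [G sG /= ->]]; first by exists F.
exists (derive_factor G j); first exact: smooth1_derive_factor.
exact: partial_tensor.
Qed.

Definition bump3 (a : X) (d : R) : X -> R := tensor (fun i => bump1 (a 0 i) d).

Lemma bump3_ge0 a d x : 0 <= bump3 a d x.
Proof. by apply: prodr_ge0 => i _; exact: bump1_ge0. Qed.

Lemma bump1_le1 (a d x : R) : bump1 a d x <= 1.
Proof.
have f1 (y : R) : 0 <= flat 0 y <= 1.
  rewrite /flat; case: ifPn => y0; rewrite ?lexx ?ler01 // expr0 mul1r expR_ge0 /=.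
  by rewrite -expR0 ler_expR oppr_le0 invr_ge0 ltW.
by rewrite /bump1; apply: mulr_ile1;
  case/andP: (f1 (x - (a - d))); case/andP: (f1 (a + d - x)).
Qed.

Lemma bump3_le1 a d x : bump3 a d x <= 1.
Proof. by apply: prodr_ile1 => i _; rewrite bump1_ge0 bump1_le1. Qed.

Lemma bump3_eq0 (a : X) (d : R) (x : X) i : d <= `|x 0 i - a 0 i| -> bump3 a d x = 0.
Proof. by move=> h; rewrite /bump3 /tensor (bigD1 i) //= bump1_eq0 // mul0r. Qed.

Lemma smooth_bump3 a d : smooth (bump3 a d).
Proof. by apply: smooth_tensor => i; exact: smooth1_bump1. Qed.

Lemma vanishes_outside_bump1 (a d : R) : vanishes_outside (`|a| + `|d|) (bump1 a d).
Proof.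
move=> x h; apply: bump1_eq0; apply: le_trans (lerB_dist _ _).
by rewrite lerBrDl (le_trans _ (ltW h)) // lerD2l ler_norm.
Qed.

Lemma compactly_supported_bump3 a d : compactly_supported (bump3 a d).
Proof.
exists (`|a| + `|d|) => x h.
have [i hi] : exists i, `|a 0 i| + `|d| < `|x 0 i|.
  apply/existsP; rewrite -[X in is_true X]negbK; apply/negP => /existsPn H.
  have : `|x| <= `|a| + `|d|.
    apply: norm_le3 => i; have := H i; rewrite -leNgt => /le_trans; apply.
    by rewrite lerD2r coord_le_norm.
  by rewrite leNgt h.
by rewrite /bump3 /tensor (bigD1 i) //= vanishes_outside_bump1 // mul0r.
Qed.

Lemma integrable_bump1 (a d : R) : mu.-integrable setT (EFin \o bump1 a d).
Proof.
apply: integrable_continuous; last exact: vanishes_outside_bump1.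
exact: smooth1_continuous (smooth1_bump1 a d).
Qed.

(** The bump is bounded below by a positive constant on the middle half of its
    support. *)
Lemma Rintegral_bump1_gt0 (a d : R) : 0 < d -> 0 < \int[mu]_x bump1 a d x.
Proof.
move=> d0.
pose c := expR (- (d / 2)^-1) ^+ 2.
have c0 : 0 < c by rewrite exprn_gt0 ?expR_gt0.
pose I := `[a - d / 2, a + d / 2]%classic : set (measurableTypeR R).
have mI : measurable I by exact: measurable_itv.
have le_bump1 x : c * \1_I x <= bump1 a d x.
  rewrite indicE; case: (boolP (x \in I)); last by rewrite mulr0 bump1_ge0.
  rewrite inE /I /= in_itv /= mulr1 => /andP[h1 h2].
  have fl y : d / 2 <= y -> expR (- (d / 2)^-1) <= flat 0 y.
    move=> dy; have y0 : 0 < y by apply: lt_le_trans dy; rewrite divr_gt0.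
    by rewrite /flat y0 expr0 mul1r ler_expR lerN2 lef_pV2 // posrE divr_gt0.
  by rewrite /c expr2 /bump1; apply: ler_pM; rewrite ?expR_ge0 //; apply: fl; lra.
have iI : mu.-integrable setT (EFin \o (fun x => c * \1_I x)).
  apply: (@eq_integrable _ _ _ _ _ measurableT (fun x => c%:E * (EFin \o \1_I) x)%E) => //.
  apply: integrableZl => //; exact: integrable_indic_itv.
apply: lt_le_trans (le_Rintegral measurableT iI (integrable_bump1 a d)
  (fun x _ => le_bump1 x)).
rewrite RintegralZl //; last exact: integrable_indic_itv.
rewrite mulr_gt0 // /Rintegral integral_indic // setIT /= lebesgue_measure_itv /= lte_fin.
rewrite ifT; last by lra.
by rewrite -EFinB /= ; lra.
Qed.

Lemma bump3_vec3 a d (p : R3) : bump3 a d (vec3 p) =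
  triple_tensor (bump1 (a 0 0) d) (bump1 (a 0 1) d) (bump1 (a 0 (1 + 1)) d) p.
Proof. by rewrite /bump3 tensorE !vec3E. Qed.

Lemma integrable_bump3 a d : leb3.-integrable setT (EFin \o bump3 a d \o vec3).
Proof.
rewrite (_ : _ \o _ = EFin \o
    triple_tensor (bump1 (a 0 0) d) (bump1 (a 0 1) d) (bump1 (a 0 (1 + 1)) d)).
  by apply: integrable_triple_tensor; exact: integrable_bump1.
by apply/funext => p; rewrite /= bump3_vec3.
Qed.

Lemma Rintegral_bump3_gt0 a d : 0 < d -> 0 < \int[leb3]_p bump3 a d (vec3 p).
Proof.
move=> d0; under eq_Rintegral do rewrite bump3_vec3.
rewrite Rintegral_triple_tensor; [|exact: integrable_bump1..].
by rewrite !mulr_gt0 ?Rintegral_bump1_gt0.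
Qed.
End TestFunctions.

(** * Vanishing Fourier coefficients *)

Section FourierUniqueness.
Context {R : realType}.
Local Notation X := 'rV[R]_3.
Local Notation R3 :=
  (measurableTypeR R * measurableTypeR R * measurableTypeR R)%type.
Local Notation Re := (@complex.Re R).
Local Notation Im := (@complex.Im R).
Local Open Scope complex_scope.
Implicit Types (f g : X -> R[i]) (D : set X) (c : R[i]) (psi : X -> R).

Definition ccontinuous f := continuous (Re \o f) /\ continuous (Im \o f).

(** Multiplying f by the conjugate of f a makes its value at a positive, so that
    signs can be discussed on the real part alone. *)
Definition cconj c : R[i] := Re c -i* Im c.

Lemma Re_cconjM c z : Re (cconj c * z) = Re c * Re z + Im c * Im z.
Proof. by case: c => ? ?; case: z => ? ? /=; ring. Qed.

Lemma continuous_gt_cube (h : X -> R) (a : X) (m : R) : continuous h -> m < h a ->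
  exists2 d : R, 0 < d & forall x : X, (forall i, `|x 0 i - a 0 i| < d) -> m < h x.
Proof.
move=> ch ma.
have : \forall x \near a, m < h x by exact: (cvgr_gt _ (ch a)).
move=> /nbhs_ballP[d /= d0 hd]; exists d => // x xa; apply: hd.
rewrite /= mx_norm_ball /ball_ /=; apply: norm_lt3 => // i.
by rewrite !mxE distrC.
Qed.

Lemma local_positivity f (a : X) : ccontinuous f -> f a <> 0 ->
  exists m d : R, [/\ 0 < m, 0 < d & forall x : X, (forall i, `|x 0 i - a 0 i| < d) ->
    m <= Re (cconj (f a) * f x)].
Proof.
move=> [cr ci] fa.
have q0 : 0 < csqnorm (f a).
  by rewrite lt_neqAle csqnorm_ge0 andbT eq_sym; apply/eqP => /csqnorm_eq0.
pose h x := Re (f a) * Re (f x) + Im (f a) * Im (f x).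
have ch : continuous h.
  have c1 : continuous (fun x => Re (f a) * (Re \o f) x).
    by move=> x; apply: continuousM; [exact: cst_continuous|exact: cr].
  have c2 : continuous (fun x => Im (f a) * (Im \o f) x).
    by move=> x; apply: continuousM; [exact: cst_continuous|exact: ci].
  by move=> x; exact: cvgD (c1 x) (c2 x).
have ha : csqnorm (f a) / 2 < h a by rewrite /h -!expr2 -/(csqnorm (f a)); lra.
have [d d0 hd] := continuous_gt_cube ch ha.
exists (csqnorm (f a) / 2), d; split=> //; first by rewrite divr_gt0.
by move=> x /hd /ltW; rewrite Re_cconjM.
Qed.

(** Integrability is part of the notion so that it is closed under linear
    combinations. *)
Definition null_integral D f := cintegrable D f /\ cintegral D f = 0.

Lemma null_integralZ D c f : measurable (vec3 @^-1` D : set R3) ->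
  null_integral D f -> null_integral D (fun x => c * f x).
Proof.
move=> mD [fi f0]; split; first exact: cintegrableZ.
by rewrite cintegralZ // f0 mulr0.
Qed.

Lemma null_integralD D f g : measurable (vec3 @^-1` D : set R3) ->
  null_integral D f -> null_integral D g -> null_integral D (fun x => f x + g x).
Proof.
move=> mD [fi f0] [gi g0]; split; first exact: cintegrableD.
by rewrite cintegralD // f0 g0 addr0.
Qed.

Lemma expiD (s t : R) : expi (s + t) = expi s * expi t :> R[i].
Proof. by rewrite /expi cosD sinD; apply: complex_ext => /=; ring. Qed.

Lemma cos_expi (t : R) : (cos t)%:C = (2^-1)%:C * (expi t + expi (- t)).
Proof.
by rewrite /expi cosN sinN; apply: complex_ext => /=; [field|ring].
Qed.

Definition mode (k : 'rV[int]_3) (x : X) : R[i] := expi (- dot (frequency k) x).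

Lemma mode_shift (k : 'rV[int]_3) (n : int) i x :
  mode (k - n *: delta_mx 0 i) x = mode k x * expi (n%:~R * x 0 i).
Proof.
rewrite /mode -expiD; congr expi; rewrite /dot /frequency.
under eq_bigr do rewrite !mxE rmorphB rmorphM /= mulrBl.
rewrite sumrB opprB addrC; congr (_ + _).
  by congr (- _); apply: eq_bigr => j _; rewrite !mxE.
rewrite (bigD1 i) //= !eqxx mulr1 big1 ?addr0 // => j ji.
by rewrite (negbTE ji) ?andbF /= ?rmorph0 ?mulr0 mul0r.
Qed.

(** A trigonometric polynomial with values in [eta, 1 + eta], equal to 1 + eta
    exactly at a modulo periods: its powers concentrate at a. *)
Definition trig_kernel (eta : R) (a x : X) : R :=
  2^-1 + eta + 6^-1 * \sum_i cos (x 0 i - a 0 i).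

(** Multiplication by the kernel turns a mode into a combination of seven modes
    of neighbouring frequencies. *)
Lemma null_mode_kernel f (h : X -> R) eta (a : X) :
  (forall k, null_integral cell (fun x => f x * (h x)%:C * mode k x)) ->
  forall k, null_integral cell
    (fun x => f x * (h x * trig_kernel eta a x)%:C * mode k x).
Proof.
move=> H k; have mc := @measurable_cell R.
pose u k x := f x * (h x)%:C * mode k x.
pose q : R[i] := (12^-1)%:C.
pose v i (x : X) := (q * expi (- a 0 i)) * u (k - 1 *: delta_mx 0 i) x
                    + (q * expi (a 0 i)) * u (k - (-1) *: delta_mx 0 i) x.
have Nv i : null_integral cell (v i).
  by apply: null_integralD => //; apply: null_integralZ => //; exact: H.
have -> : (fun x => f x * (h x * trig_kernel eta a x)%:C * mode k x) =
    (fun x => (2^-1 + eta)%:C * u k x + ((v 0 x + v 1 x) + v (1 + 1) x)).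
  apply/funext => x; rewrite /v /u !mode_shift.
  have cE i : (cos (x 0 i - a 0 i))%:C = (2^-1)%:C *
      (expi (1%:~R * x 0 i) * expi (- a 0 i) + expi ((-1)%:~R * x 0 i) * expi (a 0 i)).
    by rewrite cos_expi -!expiD opprB mulN1r mul1r (addrC (- x 0 i)).
  have qE : (6^-1 : R)%:C * (2^-1)%:C = q.
    by rewrite -rmorphM /q; congr (_ %:C); field.
  rewrite /trig_kernel sum3E !rmorphM !rmorphD rmorphM !rmorphD /= !cE -!mulrDr.
  rewrite (mulrA (6^-1)%:C) qE.
  ring.
apply: null_integralD => //; first by apply: null_integralZ => //; exact: H.
by apply: null_integralD => //; apply: null_integralD.
Qed.

Lemma cos_anti (x y : R) : 0 <= y -> y <= x -> x <= pi -> cos x <= cos y.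
Proof.
move=> y0 yx xpi.
have yI : y \in `[0, pi] by rewrite in_itv /= y0 (le_trans yx).
have xI : x \in `[0, pi] by rewrite in_itv /= xpi (le_trans y0).
by rewrite leNgt ltr_cos // -leNgt.
Qed.

Lemma cos_le_away (d t : R) : 0 <= d -> d <= `|t| -> `|t| <= 2 * pi - d ->
  cos t <= cos d.
Proof.
move=> d0 dt tpi.
have -> : cos t = cos `|t| by case: (ger0P t) => // _; rewrite cosN.
move: `|t| dt tpi => {}t dt tpi.
have [tp|/ltW tp] := leP t pi.
  exact: cos_anti.
have -> : cos t = cos (2 * pi - t).
  by rewrite cosB mulr_natl cos2pi sin2pi mul1r mul0r addr0.
by apply: cos_anti; lra.
Qed.

Lemma cos_lt1 (d : R) : 0 < d -> d <= pi -> cos d < 1.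
Proof.
move=> d0 dpi; rewrite -[ltRHS]cos0 ltr_cos // in_itv /= ?lexx ?pi_ge0 //.
by rewrite (ltW d0).
Qed.

Lemma trig_kernel_ge0 (eta : R) (a x : X) : 0 <= eta ->
  0 <= trig_kernel eta a x.
Proof.
move=> eta0; rewrite /trig_kernel sum3E.
have := (cos_geN1 (x 0 0 - a 0 0), cos_geN1 (x 0 1 - a 0 1),
  cos_geN1 (x 0 (1 + 1) - a 0 (1 + 1))).
move=> [[h0 h1] h2]; lra.
Qed.

Lemma trig_kernel_away (d : R) (a x : X) i : 0 <= d -> d <= `|x 0 i - a 0 i| ->
  `|x 0 i - a 0 i| <= 2 * pi - d -> trig_kernel (6^-1 * (1 - cos d)) a x <= 1.
Proof.
move=> d0 h1 h2; have := cos_le_away d0 h1 h2; rewrite /trig_kernel sum3E.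
have := (cos_le1 (x 0 0 - a 0 0), cos_le1 (x 0 1 - a 0 1),
  cos_le1 (x 0 (1 + 1) - a 0 (1 + 1))).
move=> [[]]; move: i {h1 h2}; apply: ord3P => *; lra.
Qed.

Lemma trig_kernel_near (eta e : R) (a x : X) :
  (forall i, 1 - e <= cos (x 0 i - a 0 i)) ->
  1 + eta - 2^-1 * e <= trig_kernel eta a x.
Proof.
move=> h; rewrite /trig_kernel sum3E.
have := (h 0, h 1, h (1 + 1)) => -[[h0 h1] h2]; lra.
Qed.

(** Bernoulli's inequality. *)
Lemma no_geometric_bound (A B eta : R) : 0 < A -> 0 < eta ->
  ~ (forall n, A * (1 + eta) ^+ n <= B).
Proof.
move=> A0 eta0 H.
have Ae : 0 < A * eta by rewrite mulr_gt0.
pose n := (Num.truncn (B / (A * eta))).+1.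
have hn : B < A * eta * n%:R.
  by rewrite mulrC -ltr_pdivrMr //; exact: Num.Theory.truncnS_gt.
have bern : forall k, 1 + eta * k%:R <= (1 + eta) ^+ k.
  elim=> [|k IH]; first by rewrite mulr0 addr0.
  rewrite exprS -natr1.
  have k0 : 0 <= k%:R :> R by rewrite ler0n.
  have := ler_wpM2l (ltW (addr_gt0 ltr01 eta0)) IH.
  have := mulr_ge0 (mulr_ge0 (ltW eta0) (ltW eta0)) k0.
  nra.
have := le_trans (ler_wpM2l (ltW A0) (bern n)) (H n).
rewrite mulrDr mulr1 mulrA; lra.
Qed.

(** The bump is supported in the cell. *)
Lemma Rintegral_cell_bump3 (a : X) (d : R) :
  (forall i, d <= a 0 i) -> (forall i, d <= 2 * pi - a 0 i) ->
  \int[leb3]_(p in vec3 @^-1` cell) bump3 a d (vec3 p) =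
  \int[leb3]_p bump3 a d (vec3 p).
Proof.
move=> ha ha'; rewrite Rintegral_mkcond; apply: eq_Rintegral => p _.
rewrite patchE; case: ifPn => //; rewrite notin_setE /= => np.
apply/esym; apply: contra_notP np => nb i; apply/andP.
have : ~ d <= `|vec3 p 0 i - a 0 i| by move=> /bump3_eq0.
move=> /negP; rewrite -ltNge ltr_norml => /andP[h1 h2].
have := ha i; have := ha' i; split; lra.
Qed.

(** Let F be the real part of conj (f a) f, bounded below by m > 0 near a, and P
    the kernel. The integral of F P^n over the cell is 0. Near a the integrand
    is nonnegative, and it is at least m (1 + eta / 2)^n on a smaller cube; away
    from a it is at least - |F|. So a geometric sequence times the integral of
    a bump would be bounded by the integral of |F|. *)
Lemma eq0_of_null_modes f (a : X) : ccontinuous f -> clocally_integrable f ->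
  (forall k, null_integral cell (fun x => f x * mode k x)) ->
  (forall i, 0 < a 0 i < 2 * pi) -> f a = 0.
Proof.
move=> cf lf Hf acell; apply: contrapT => fa.
have [m [d0 [m0 d00 hm]]] := local_positivity cf fa.
have mc := @measurable_cell R.
have [d [d_gt0 dd0 da da']] : exists d : R, [/\ 0 < d, d <= d0,
    forall i, d <= a 0 i & forall i, d <= 2 * pi - a 0 i].
  have ai i := acell i.
  exists (Num.min d0 (\big[Num.min/d0]_i Num.min (a 0 i) (2 * pi - a 0 i))); split.
  - rewrite lt_min d00 /=; apply: lt_bigmin => // i _.
    by rewrite lt_min subr_gt0 ai.
  - by rewrite ge_min lexx.
  - move=> i; rewrite ge_min; apply/orP; right.
    by apply: (bigmin_inf i) => //; rewrite ge_min lexx.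
  - move=> i; rewrite ge_min; apply/orP; right.
    by apply: (bigmin_inf i) => //; rewrite ge_min lexx orbT.
have dpi : d <= pi by have := (da 0, da' 0) => -[h1 h2]; lra.
(* with this eta the kernel is at most 1 at the points of the cell that have a
   coordinate at distance at least d from that of a *)
pose eta := 6^-1 * (1 - cos d).
have eta0 : 0 < eta by rewrite mulr_gt0 ?invr_gt0 ?subr_gt0 ?cos_lt1.
(* on the cube of radius d2 the kernel is at least 1 + eta / 2 *)
have [d1 d10 hd1] : exists2 d1 : R, 0 < d1 & forall t, `|t| < d1 -> 1 - eta < cos t.
  have c0 : cos t @[t --> (0 : R)] --> (1 : R).
    by rewrite -cos0; exact: continuous_cos.
  have : \forall t \near (0 : R), 1 - eta < cos t.
    by apply: (cvgr_gt _ c0); rewrite ltrBlDr ltrDl.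
  move=> /nbhs_ballP[d1 /= d10 h]; exists d1 => // t td; apply: h.
  by rewrite /ball /= sub0r normrN.
pose d2 := Num.min d d1.
have d20 : 0 < d2 by rewrite lt_min d_gt0.
pose P := trig_kernel eta a.
pose F x := Re (cconj (f a) * f x).
have Nn n k : null_integral cell (fun x => f x * (P x ^+ n)%:C * mode k x).
  elim: n k => [|n IH] k.
    rewrite (_ : (fun x => _) = fun x => f x * mode k x) //.
    by apply/funext => x; rewrite expr0 mulr1.
  under eq_fun do rewrite exprSr.
  exact: null_mode_kernel.
have NF n : leb3.-integrable (vec3 @^-1` cell)
      (EFin \o (fun p => F (vec3 p) * P (vec3 p) ^+ n)) /\
    \int[leb3]_(p in vec3 @^-1` cell) (F (vec3 p) * P (vec3 p) ^+ n) = 0.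
  have E : (fun p : R3 => F (vec3 p) * P (vec3 p) ^+ n) =
      Re \o (fun x => cconj (f a) * (f x * (P x ^+ n)%:C * mode 0 x)) \o vec3.
    apply/funext => p; rewrite /= /mode /F.
    have -> : dot (frequency 0) (vec3 p) = 0.
      by rewrite /dot big1 // => i _; rewrite !mxE mul0r.
    rewrite oppr0 (_ : expi 0 = 1 :> R[i]); last by rewrite /expi cos0 sin0.
    by rewrite mulr1 mulrA [in RHS]complexReM /= mulr0 subr0.
  have [[ir _] i0] := null_integralZ (cconj (f a)) mc (Nn n 0).
  rewrite E; split=> //.
  by have := congr1 Re i0.
have Fi : leb3.-integrable (vec3 @^-1` cell) (EFin \o (F \o vec3)).
  apply: eq_integrable (NF 0%N).1 => // p _.
  by rewrite /= expr0 mulr1.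
have Fai : leb3.-integrable (vec3 @^-1` cell) (EFin \o (fun p => `|F (vec3 p)|)).
  exact: integrable_norm Fi.
have bi : leb3.-integrable (vec3 @^-1` cell) (EFin \o (fun p => bump3 a d2 (vec3 p))).
  by apply: integrableS (integrable_bump3 a d2).
pose I := \int[leb3]_p bump3 a d2 (vec3 p).
have I0 : 0 < I by exact: Rintegral_bump3_gt0.
have mI0 : 0 < m * I by rewrite mulr_gt0.
apply: (@no_geometric_bound (m * I)
  (\int[leb3]_(p in vec3 @^-1` cell) `|F (vec3 p)|) (2^-1 * eta)) => // [|n].
  by rewrite mulr_gt0.
have lb p : (vec3 @^-1` cell) p ->
   m * (1 + 2^-1 * eta) ^+ n * bump3 a d2 (vec3 p) - `|F (vec3 p)| <=
   F (vec3 p) * P (vec3 p) ^+ n.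
  move=> cp; set x := vec3 p.
  have P0 : 0 <= P x by apply: trig_kernel_ge0; exact: ltW.
  have [near_a|/existsNP[i /negP]] := pselect (forall i, `|x 0 i - a 0 i| < d).
    have Fx : m <= F x by apply: hm => i; exact: lt_le_trans (near_a i) dd0.
    have F0 : 0 <= F x by apply: le_trans Fx; exact: ltW.
    have [near2|/existsNP[i /negP]] := pselect (forall i, `|x 0 i - a 0 i| < d2).
      apply: le_trans (_ : m * (1 + 2^-1 * eta) ^+ n <= _).
        apply: le_trans (_ : m * (1 + 2^-1 * eta) ^+ n * bump3 a d2 x <= _).
          by rewrite lerBlDr lerDl.
        rewrite ler_piMr ?bump3_le1 // mulr_ge0 ?(ltW m0) // exprn_ge0 //.
        by rewrite addr_ge0 // mulr_ge0 // ltW.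
      apply: ler_pM => //; first exact: ltW.
        by rewrite exprn_ge0 // addr_ge0 // mulr_ge0 // ltW.
      apply: lerXn2r; rewrite ?nnegrE //.
        by rewrite addr_ge0 // mulr_ge0 // ltW.
      have : 1 + eta - 2^-1 * eta <= P x.
        apply: trig_kernel_near => j; apply/ltW/hd1.
        by apply: lt_le_trans (near2 j) _; rewrite ge_min lexx orbT.
      lra.
    rewrite -leNgt => /bump3_eq0 ->; rewrite mulr0 sub0r.
    apply: (@le_trans _ _ 0); first by rewrite oppr_le0.
    by rewrite mulr_ge0 // exprn_ge0.
  rewrite -leNgt => far.
  have -> : bump3 a d2 x = 0.
    by apply: (@bump3_eq0 _ _ _ _ i); apply: le_trans far; rewrite ge_min lexx.
  rewrite mulr0 sub0r.
  have P1 : P x <= 1.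
    apply: (@trig_kernel_away d a x i) => //; first exact: ltW.
    have /andP[x0 x1] := cp i; have := da i; have := da' i => h1 h2.
    by rewrite ler_norml -/x; apply/andP; split; rewrite -/x in x0 x1 *; lra.
  rewrite lerNl; apply: le_trans (ler_norm _) _.
  by rewrite normrN normrM ler_piMr // ger0_norm ?exprn_ge0 // exprn_ile1.
have ci : leb3.-integrable (vec3 @^-1` cell)
   (EFin \o (fun p => m * (1 + 2^-1 * eta) ^+ n * bump3 a d2 (vec3 p))).
  exact: integrableZ_EFin.
have := le_Rintegral mc (integrableB_EFin mc ci Fai) (NF n).1 lb.
rewrite (NF n).2 RintegralB // RintegralZl // Rintegral_cell_bump3; last 2 first.
- by move=> i; apply: le_trans (da i); rewrite ge_min lexx.
- by move=> i; apply: le_trans (da' i); rewrite ge_min lexx.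
by rewrite subr_le0 mulrAC.
Qed.
End FourierUniqueness.

(** * Positivity of the Sobolev norm on the torus *)

Section TorusNorm.
Context {R : realType}.
Local Notation X := 'rV[R]_3.
Local Notation Re := (@complex.Re R).
Local Open Scope complex_scope.
Implicit Types (f g : X -> R[i]) (D : set X) (c : R[i]) (psi : X -> R).

Lemma periodic_int V (f : X -> V) (n : int) i (x : X) : Defs.periodic f ->
  f (x + (n%:~R * (2 * pi)) *: Defs.basis i) = f x.
Proof.
move=> pf.
have pn (m : nat) y : f (y + (m%:R * (2 * pi)) *: Defs.basis i) = f y.
  elim: m y => [|m IH] y; first by rewrite mul0r scale0r addr0.
  by rewrite -natr1 mulrDl mul1r scalerDl addrA pf IH.
case: n => m; first exact: pn.
rewrite NegzE rmorphN /= mulNr scaleNr -[LHS](pn m.+1) subrK //.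
Qed.

Lemma shift_to_cell V (f : X -> V) (x : X) : Defs.periodic f ->
  exists2 y, cell y & f y = f x.
Proof.
move=> pf; have tp : 0 < 2 * pi :> R by rewrite mulr_gt0 ?pi_gt0.
pose n i := - Num.floor (x 0 i / (2 * pi)).
pose sh (z : X) i := z + ((n i)%:~R * (2 * pi)) *: Defs.basis i.
exists (sh (sh (sh x 0) 1) (1 + 1)); last by rewrite /sh !periodic_int.
move=> i.
have -> : sh (sh (sh x 0) 1) (1 + 1) 0 i = x 0 i + (n i)%:~R * (2 * pi).
  by rewrite /sh /Defs.basis !mxE; move: i; apply: ord3P; rewrite /= ?mulr0 ?mulr1 ?addr0.
have /andP[h1 h2] := floor_itv (x 0 i / (2 * pi)).
move: h1 h2; rewrite ler_pdivlMr // ltr_pdivrMr // intrD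
   (mulrDl _%:~R 1%:~R) (mul1r (2 * pi)) => h1 h2.
by rewrite /n rmorphN /= mulNr subr_ge0 h1 /= ltrBlDr addrC.
Qed.

(** The half-open cell has boundary points, but from each of them a small
    step in the direction (1, 1, 1) leads inside. *)
Lemma nonzero_in_open_cell f (y : X) : ccontinuous f -> cell y -> f y <> 0 ->
  exists2 z : X, (forall i, 0 < z 0 i < 2 * pi) & f z <> 0.
Proof.
move=> cf cy fy; have [m [d [m0 d0 hd]]] := local_positivity cf fy.
pose e := Num.min d (\big[Num.min/d]_i (2 * pi - y 0 i)) / 2.
have e0 : 0 < e.
  rewrite divr_gt0 // lt_min d0 /=; apply: lt_bigmin => // i _.
  by rewrite subr_gt0; case/andP: (cy i).
have ed : e < d.
  rewrite /e ltr_pdivrMr //; apply: le_lt_trans (_ : d < _).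
    by rewrite ge_min lexx.
  lra.
have ey i : e < 2 * pi - y 0 i.
  have yi : 0 < 2 * pi - y 0 i by rewrite subr_gt0; case/andP: (cy i).
  rewrite /e ltr_pdivrMr //; apply: le_lt_trans (_ : 2 * pi - y 0 i < _).
    by rewrite ge_min; apply/orP; right; apply: (bigmin_inf i).
  lra.
exists (y + const_mx e) => [i|].
  rewrite !mxE; have /andP[y0 _] := cy i; have := ey i => ?.
  by apply/andP; split; lra.
move=> fz; have : m <= Re (cconj (f y) * f (y + const_mx e)).
  by apply: hd => i; rewrite !mxE addrAC subrr add0r gtr0_norm.
by rewrite fz mulr0 /= leNgt m0.
Qed.

(** A norm 0 forces every Fourier coefficient to be 0, as the weights are
    positive; then f vanishes in the open cell, hence everywhere by periodicity
    and continuity. *)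
Lemma sobolev_norm_torus_gt0 s f : Defs.periodic f -> ccontinuous f ->
  clocally_integrable f -> (exists x, f x <> 0) -> (0 < sobolev_norm_torus s f)%E.
Proof.
move=> pf cf lf [x fx].
rewrite lt_neqAle sobolev_norm_torus_ge0 andbT eq_sym; apply/eqP => n0.
have [y cy fy] := shift_to_cell x pf.
rewrite -fy in fx.
have [z cz fz] := nonzero_in_open_cell cf cy fx.
apply: fz; apply: eq0_of_null_modes => // k.
have w0 j : (0 <= (sobolev_weight s (frequency j) * csqnorm (fourier_coef f j))%:E)%E.
  by rewrite lee_fin mulr_ge0 ?sobolev_weight_ge0 ?csqnorm_ge0.
have sum0 := poweR_eq0_eq0 (esum_ge0 (fun j _ => w0 j)) n0.
have k0 : ((sobolev_weight s (frequency k) * csqnorm (fourier_coef f k))%:E <= 0)%E.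
  rewrite -sum0; apply: esum_ge; exists [set k]; first by split; [exact: finite_set1|].
  by rewrite fsbig_set1.
have : csqnorm (fourier_coef f k) = 0.
  apply/eqP; rewrite eq_le csqnorm_ge0 andbT.
  by move: k0; rewrite lee_fin pmulr_rle0 // sobolev_weight_gt0.
move=> /csqnorm_eq0 /eqP.
rewrite /fourier_coef mulf_eq0 => /orP[/eqP h|/eqP h].
  have : (2 * pi) ^- 3 = 0 :> R by have := congr1 Re h.
  by move=> /eqP; rewrite invr_eq0 expf_eq0 /= mulf_eq0 pnatr_eq0 /= gt_eqF // pi_gt0.
by split=> //; exact: cintegrable_mode.
Qed.
End TorusNorm.

(** * Rapid decay of the transform of a bump function *)

Section FourierDecay.
Context {R : realType}.
Local Notation X := 'rV[R]_3.
Local Notation R3 :=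
  (measurableTypeR R * measurableTypeR R * measurableTypeR R)%type.
Local Notation mu := (@lebesgue_measure R).
Local Notation Re := (@complex.Re R).
Local Notation Im := (@complex.Im R).
Local Open Scope complex_scope.
Implicit Types (f g : X -> R[i]) (D : set X) (c : R[i]) (psi : X -> R).

(** An integrable weight on R^3 that factors over the coordinates and whose
    inverse dominates 1 + |xi|^2. *)
Definition cauchy_weight (xi : X) : R := \prod_i (1 + xi 0 i ^+ 2)^-1.

Lemma cauchy_factor (t : R) : 0 < (1 + t ^+ 2)^-1 <= 1.
Proof.
have h : 1 <= 1 + t ^+ 2 by rewrite lerDl sqr_ge0.
by rewrite invr_gt0 invf_le1 ?h ?(lt_le_trans ltr01 h).
Qed.

Lemma cauchy_weight_gt0 xi : 0 < cauchy_weight xi.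
Proof. by apply: prodr_gt0 => i _; case/andP: (cauchy_factor (xi 0 i)). Qed.

Lemma cauchy_weight_le1 xi : cauchy_weight xi <= 1.
Proof.
by apply: prodr_ile1 => i _; case/andP: (cauchy_factor (xi 0 i)) => /ltW -> ->.
Qed.

Lemma integrable_cauchy :
  mu.-integrable setT (EFin \o (fun t : R => (1 + t ^+ 2)^-1)).
Proof.
have c : continuous (fun t : R => (1 + t ^+ 2)^-1) by exact: continuous_oneDsqrV.
apply/integrableP; split.
  by apply/measurable_EFinP; exact: continuous_measurable_fun.
under eq_integral.
  move=> t _; rewrite /= ger0_norm; last by case/andP: (cauchy_factor t) => /ltW.
  over.
rewrite ge0_symfun_integralT //.
- rewrite (_ : [set x : R | 0 <= x] = `[0, +oo[%classic); last first.
    by apply/seteqP; split=> t /=; rewrite in_itv /= andbT.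
  by rewrite integral0y_oneDsqr -EFinM ltry.
- by move=> t; case/andP: (cauchy_factor t) => /ltW.
- by move=> t; rewrite /= sqrrN.
Qed.

Lemma integrable_cauchy_weight :
  leb3.-integrable setT (EFin \o cauchy_weight \o vec3).
Proof.
have h := integrable_triple_tensor integrable_cauchy integrable_cauchy integrable_cauchy.
apply: eq_integrable h => // p _.
by rewrite /= /cauchy_weight prod3E !vec3E.
Qed.

Lemma cos_sum3 (x y z : R) : cos (x + y + z) =
  cos x * cos y * cos z - cos x * sin y * sin z - sin x * cos y * sin z
  - sin x * sin y * cos z.
Proof. by rewrite !cosD !sinD; ring. Qed.

(** The cosine of a sum of three phases is a combination of products of
    one-variable waves, so the integral splits into products of
    one-dimensional transforms, each of which decays. *)
Lemma bump3_wave_decay (a : X) (d : R) k : exists2 C : R, 0 <= C &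
  forall xi theta,
    leb3.-integrable setT
      (EFin \o (fun p : R3 => bump3 a d (vec3 p) * cos (dot xi (vec3 p) + theta))) /\
    `|\int[leb3]_p (bump3 a d (vec3 p) * cos (dot xi (vec3 p) + theta))|
      <= C * cauchy_weight xi ^+ k.
Proof.
have H i := wave_transform_decay k (@smooth1_bump1 R (a 0 i) d)
  (@vanishes_outside_bump1 R (a 0 i) d).
have [C0 H0] := H 0; have [C1 H1] := H 1; have [C2 H2] := H (1 + 1).
have Cge C i : (forall xi theta : R, (1 + xi ^+ 2) ^+ k *
    `|wave_transform (bump1 (a 0 i) d) xi theta| <= C) -> 0 <= C.
  move=> h; apply: le_trans (h 0 0).
  by rewrite mulr_ge0 ?exprn_ge0 ?addr_ge0 ?sqr_ge0.
have C0ge := Cge _ _ H0; have C1ge := Cge _ _ H1; have C2ge := Cge _ _ H2.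
exists (4 * (C0 * C1 * C2)); first by rewrite !mulr_ge0.
move=> xi theta.
pose w i t (x : R) := bump1 (a 0 i) d x * wave (xi 0 i) t x.
have wi i t : mu.-integrable setT (EFin \o w i t).
  apply: integrable_wave; last exact: vanishes_outside_bump1.
  exact: smooth1_continuous (smooth1_bump1 _ _).
pose T t0 t1 t2 := triple_tensor (w 0 t0) (w 1 t1) (w (1 + 1) t2).
have Ti t0 t1 t2 : leb3.-integrable setT (EFin \o T t0 t1 t2).
  exact: integrable_triple_tensor.
have Tle t0 t1 t2 : `|\int[leb3]_p T t0 t1 t2 p| <= C0 * C1 * C2 * cauchy_weight xi ^+ k.
  rewrite Rintegral_triple_tensor // !normrM /cauchy_weight prod3E.
  have le1 C (x y : R) : (1 + x ^+ 2) ^+ k * `|y| <= C -> `|y| <= C * (1 + x ^+ 2)^-1 ^+ k.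
    have x0 : 0 < 1 + x ^+ 2 by rewrite ltr_pwDl ?sqr_ge0.
    by rewrite exprVn ler_pdivlMr ?exprn_gt0 // mulrC.
  rewrite !exprMn.
  have -> : C0 * C1 * C2 * ((1 + xi 0 0 ^+ 2)^-1 ^+ k *
      (1 + xi 0 1 ^+ 2)^-1 ^+ k * (1 + xi 0 (1 + 1) ^+ 2)^-1 ^+ k)
    = (C0 * (1 + xi 0 0 ^+ 2)^-1 ^+ k) * (C1 * (1 + xi 0 1 ^+ 2)^-1 ^+ k) *
      (C2 * (1 + xi 0 (1 + 1) ^+ 2)^-1 ^+ k) by ring.
  have l0 := le1 _ _ _ (H0 (xi 0 0) t0); have l1 := le1 _ _ _ (H1 (xi 0 1) t1).
  have l2 := le1 _ _ _ (H2 (xi 0 (1 + 1)) t2).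
  apply: (ler_pM _ _ _ l2); rewrite ?mulr_ge0 //.
  exact: (ler_pM _ _ l0 l1).
(* sin y = cos (y + q) *)
pose q := - (pi / 2) : R.
have E p : bump3 a d (vec3 p) * cos (dot xi (vec3 p) + theta) =
   T 0 0 theta p - T 0 q (theta + q) p - T q 0 (theta + q) p - T q q theta p.
  rewrite bump3_vec3 dotE !vec3E -addrA cos_sum3.
  rewrite /T /triple_tensor /w /wave !addr0 !addrA /q !cosBpihalf; ring.
have i1 := integrableB_EFin measurableT (Ti 0 0 theta) (Ti 0 q (theta + q)).
have i2 := integrableB_EFin measurableT i1 (Ti q 0 (theta + q)).
have i3 := integrableB_EFin measurableT i2 (Ti q q theta).
split; first by apply: eq_integrable i3 => // p _; rewrite /= E.
under eq_Rintegral do rewrite E.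
rewrite !RintegralB //.
have := (Tle 0 0 theta, Tle 0 q (theta + q), Tle q 0 (theta + q), Tle q q theta).
move: (\int[leb3]_p T 0 0 theta p) (\int[leb3]_p T 0 q (theta + q) p)
  (\int[leb3]_p T q 0 (theta + q) p) (\int[leb3]_p T q q theta p) => x1 x2 x3 x4.
have -> : 4 * (C0 * C1 * C2) * cauchy_weight xi ^+ k =
  4 * (C0 * C1 * C2 * cauchy_weight xi ^+ k) by rewrite [RHS]mulrA.
move: (C0 * C1 * C2 * cauchy_weight xi ^+ k) => B.
rewrite !ler_norml => -[[[/andP[? ?] /andP[? ?]] /andP[? ?]] /andP[? ?]].
by apply/andP; split; lra.
Qed.

(** The weight is at most (1 + |xi|^2)^-1, and 1 + |xi|^2 >= 1: any N >= - s
    works. *)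
Lemma cauchy_weight_le_sobolev s : exists N, forall xi,
  cauchy_weight xi ^+ N <= sobolev_weight s xi.
Proof.
exists (Num.truncn `|s|).+1 => xi; set N := (_.+1).
have sN : - s <= N%:R.
  by apply: le_trans (ler_norm _) _; rewrite normrN ltW // Num.Theory.truncnS_gt.
have r1 : 1 <= 1 + dot xi xi by rewrite lerDl dot_ge0.
have r0 := lt_le_trans ltr01 r1.
have rq : cauchy_weight xi <= (1 + dot xi xi)^-1.
  rewrite /cauchy_weight prod3E -!invfM lef_pV2 ?posrE //; last first.
    by rewrite !mulr_gt0 // ltr_pwDl ?sqr_ge0.
  rewrite dotE -!expr2.
  have := (sqr_ge0 (xi 0 0), sqr_ge0 (xi 0 1), sqr_ge0 (xi 0 (1 + 1))).
  move: (_ ^+ 2) (_ ^+ 2) (_ ^+ 2) => x y z [[x0 y0] z0].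
  have := (mulr_ge0 x0 y0, mulr_ge0 y0 z0, mulr_ge0 x0 z0, mulr_ge0 (mulr_ge0 x0 y0) z0).
  move=> [[[? ?] ?] ?]; nra.
apply: (@le_trans _ _ ((1 + dot xi xi)^-1 ^+ N)).
  apply: lerXn2r => //; rewrite nnegrE ?invr_ge0; first exact/ltW/cauchy_weight_gt0.
  exact: ltW.
rewrite exprVn -powR_mulrn ?(ltW r0) // -powRN /sobolev_weight.
by apply: ler_powR => //; rewrite lerNl.
Qed.

(** The transform decays like any power of [cauchy_weight]. N of these powers are
    spent on the Sobolev weight, and one is kept so that the bound, divided by
    that weight, remains integrable. *)
Lemma inverse_transform_bound s (a : X) (d : R) : exists2 K : R, 0 <= K &
  forall xi, csqnorm (inverse_transform (bump3 a d) xi)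
    <= K * cauchy_weight xi * sobolev_weight s xi.
Proof.
have [N HN] := cauchy_weight_le_sobolev s.
have [C C0 HC] := bump3_wave_decay a d N.+1.
exists (2 * C ^+ 2); first by rewrite mulr_ge0 ?sqr_ge0.
move=> xi.
have q0 := cauchy_weight_gt0 xi; have q1 := cauchy_weight_le1 xi.
have hsq (y : R) : `|y| <= C * cauchy_weight xi ^+ N.+1 ->
    y ^+ 2 <= C ^+ 2 * (cauchy_weight xi * sobolev_weight s xi).
  move=> hy; rewrite -real_normK ?num_real //.
  apply: (@le_trans _ _ ((C * cauchy_weight xi ^+ N.+1) ^+ 2)).
    apply: lerXn2r => //; rewrite nnegrE // mulr_ge0 // exprn_ge0 //; exact: ltW.
  rewrite exprMn ler_wpM2l ?sqr_ge0 //.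
  have -> : (cauchy_weight xi ^+ N.+1) ^+ 2 =
      cauchy_weight xi * (cauchy_weight xi ^+ N * cauchy_weight xi ^+ N.+1).
    by rewrite expr2 {1}exprS mulrA.
  rewrite ler_wpM2l ?(ltW q0) //; apply: le_trans (HN xi).
  by rewrite ler_piMr ?exprn_ge0 ?exprn_ile1 // ltW.
rewrite /csqnorm.
have hr : `|Re (inverse_transform (bump3 a d) xi)| <= C * cauchy_weight xi ^+ N.+1.
  have [_ h] := HC xi 0; rewrite /inverse_transform /cintegral /= preimage_setT.
  apply: le_trans h; rewrite le_eqVlt; apply/orP; left; apply/eqP; congr `|_|.
  by apply: eq_Rintegral => p _; rewrite mul0r subr0 addr0.
have hi : `|Im (inverse_transform (bump3 a d) xi)| <= C * cauchy_weight xi ^+ N.+1.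
  have [_ h] := HC xi (- (pi / 2)); rewrite /inverse_transform /cintegral /= preimage_setT.
  apply: le_trans h; rewrite le_eqVlt; apply/orP; left; apply/eqP; congr `|_|.
  by apply: eq_Rintegral => p _; rewrite mul0r addr0 cosBpihalf.
have := hsq _ hr; have := hsq _ hi; lra.
Qed.
End FourierDecay.

(** * Positivity of the Sobolev norm on the space, and the Lax quotient *)

Section LaxQuotient.
Context {R : realType}.
Local Notation X := 'rV[R]_3.
Local Notation R3 :=
  (measurableTypeR R * measurableTypeR R * measurableTypeR R)%type.
Local Notation Re := (@complex.Re R).
Local Notation Im := (@complex.Im R).
Local Open Scope complex_scope.
Implicit Types (f g : X -> R[i]) (D : set X) (c : R[i]) (psi : X -> R).

(** The weighted norm is a square root in the extended reals; below a finite
    bound it is that of a real integral. *)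
Lemma weighted_norm_lt s g (e : R) : 0 < e -> cmeasurable g ->
  (weighted_norm s g < e%:E)%E ->
  leb3.-integrable setT
    (EFin \o (fun p : R3 => sobolev_weight s (vec3 p) * csqnorm (g (vec3 p)))) /\
  (2 * pi) ^- 3 * \int[leb3]_p (sobolev_weight s (vec3 p) * csqnorm (g (vec3 p)))
    <= e ^+ 2.
Proof.
move=> e0 mg; rewrite /weighted_norm; set I := (\int[leb3]_p _)%E => We.
have I0 : (0 <= I)%E by apply: integral_ge0 => p _; exact: weighted_ge0.
have cI0 : (0 <= ((2 * pi) ^- 3)%:E * I)%E.
  by apply: mule_ge0 => //; rewrite lee_fin ltW ?twopiV_gt0.
have cIe : (((2 * pi) ^- 3)%:E * I <= (e ^+ 2)%:E)%E.
  rewrite leNgt; apply/negP => h; move: We; apply/negP; rewrite -leNgt.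
  have -> : (e%:E = (e ^+ 2)%:E `^ 2^-1)%E.
    by rewrite poweR_EFin powR12_sqrt ?sqr_ge0 // sqrtr_sqr gtr0_norm.
  apply: gt0_ler_poweR; rewrite ?in_itv /= ?leey ?andbT ?invr_ge0 ?ler0n ?lee_fin ?sqr_ge0 //.
  exact: ltW.
have Ifin : I \is a fin_num.
  rewrite ge0_fin_numE // ltNge leye_eq; apply/negP => /eqP Iy.
  by move: cIe; rewrite Iy gt0_muley ?lte_fin ?twopiV_gt0 // leye_eq.
split.
  apply/integrableP; split; first exact: measurable_weighted.
  under eq_integral do rewrite /= ger0_norm ?mulr_ge0 ?sobolev_weight_ge0 ?csqnorm_ge0 //.
  by rewrite -ge0_fin_numE.
by move: cIe; rewrite -(fineK Ifin) -EFinM lee_fin.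
Qed.

Lemma young_weighted (x y w t : R) : 0 < w -> 0 < t ->
  2 * `|x * y| <= t^-1 * (w * x ^+ 2) + t * (w^-1 * y ^+ 2).
Proof.
move=> w0 t0; rewrite normrM -(real_normK (num_real x)) -(real_normK (num_real y)).
move: `|x| `|y| => {}x {}y; pose z := t^-1 * w.
have z0 : 0 < z by rewrite mulr_gt0 ?invr_gt0.
have -> : t * (w^-1 * y ^+ 2) = z^-1 * y ^+ 2 by rewrite /z invfM invrK mulrA.
have -> : t^-1 * (w * x ^+ 2) = z * x ^+ 2 by rewrite /z mulrA.
rewrite -subr_ge0.
have -> : z * x ^+ 2 + z^-1 * y ^+ 2 - 2 * (x * y) = z * (x - z^-1 * y) ^+ 2.
  by field; rewrite gt_eqF.
by rewrite mulr_ge0 ?sqr_ge0 // ltW.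
Qed.

(** The weighted Young inequality serves as a Cauchy-Schwarz inequality between
    the weight w and its inverse: in the application B is integrable and t is
    small. *)
Lemma young_complex (z h : R[i]) (w t B : R) : 0 < w -> 0 < t ->
  csqnorm h <= B * w ->
  2 * `|Re (z * h)| <= t^-1 * (w * csqnorm z) + t * B /\
  2 * `|Im (z * h)| <= t^-1 * (w * csqnorm z) + t * B.
Proof.
move=> w0 t0 hB.
have hB' : t * (w^-1 * csqnorm h) <= t * B.
  by rewrite ler_pM2l // mulrC ler_pdivrMr.
have y1 := young_weighted (Re z) (Re h) w0 t0.
have y2 := young_weighted (Im z) (Im h) w0 t0.
have y3 := young_weighted (Re z) (Im h) w0 t0.
have y4 := young_weighted (Im z) (Re h) w0 t0.
have s1 := ler_normB (Re z * Re h) (Im z * Im h).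
have s2 := ler_normD (Re z * Im h) (Im z * Re h).
by move: hB'; rewrite complexReM complexImM /csqnorm !mulrDr; split; lra.
Qed.

(** Take a Fourier transform g of f whose weighted norm is less than e. With
    t = e in [young_complex], the first term integrates to at most e^2 / e, up
    to the factor (2 pi)^-3, and the second is e times a constant that depends on the bump only. *)
Lemma bump3_pairing_le s f (a : X) (d : R) : exists C : R, forall e : R, 0 < e ->
  (sobolev_norm_space s f < e%:E)%E ->
  `|Re (cintegral setT (fun x => f x * (bump3 a d x)%:C))| <= C * e /\
  `|Im (cintegral setT (fun x => f x * (bump3 a d x)%:C))| <= C * e.
Proof.
have [K K0 HK] := inverse_transform_bound s a d.
pose c : R := (2 * pi) ^- 3; have c0 : 0 < c := twopiV_gt0.
pose Q : R := \int[leb3]_p cauchy_weight (vec3 p).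
exists (2^-1 * (1 + c * (K * Q))) => e e0 /ereal_inf_lt[_ [g [mg fg] <-] ge].
have [[ir ii] ->] := fg _ (@smooth_bump3 R a d) (@compactly_supported_bump3 R a d).
move: ir ii; rewrite !preimage_setT => ir ii.
have [iw we] := weighted_norm_lt e0 mg ge.
pose h := inverse_transform (bump3 a d).
pose W p : R := sobolev_weight s (vec3 p) * csqnorm (g (vec3 p)).
have iQ : leb3.-integrable setT (EFin \o (fun p : R3 => cauchy_weight (vec3 p))).
  exact: integrable_cauchy_weight.
have bound (u : R3 -> R) : leb3.-integrable setT (EFin \o u) ->
    (forall p, 2 * `|u p| <= e^-1 * W p + e * (K * cauchy_weight (vec3 p))) ->
    `|c * \int[leb3]_p u p| <= 2^-1 * (1 + c * (K * Q)) * e.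
  move=> iu ub.
  have i1 : leb3.-integrable setT (EFin \o (fun p => e^-1 * W p)).
    exact: integrableZ_EFin.
  have i2 : leb3.-integrable setT (EFin \o (fun p : R3 => K * cauchy_weight (vec3 p))).
    exact: integrableZ_EFin.
  have i3 : leb3.-integrable setT (EFin \o (fun p : R3 => e * (K * cauchy_weight (vec3 p)))).
    exact: integrableZ_EFin.
  have i4 := integrableD_EFin measurableT i1 i3.
  have iN : leb3.-integrable setT (EFin \o (fun p => `|u p|)) by exact: integrable_norm iu.
  have i2N := integrableZ_EFin 2 measurableT iN.
  have le1 : 2 * \int[leb3]_p `|u p| <= e^-1 * \int[leb3]_p W p + e * (K * Q).
    have := le_Rintegral measurableT i2N i4 (fun p _ => ub p).
    by rewrite (RintegralZl _ _ iN) // RintegralD // (RintegralZl _ _ iw) //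
      (RintegralZl _ _ i2) // (RintegralZl _ _ iQ).
  have le2 : `|\int[leb3]_p u p| <= \int[leb3]_p `|u p| by exact: le_normr_Rintegral.
  rewrite normrM (gtr0_norm c0).
  have h1 : c * (e^-1 * \int[leb3]_p W p) <= e.
    rewrite mulrCA ler_pdivrMl //; apply: le_trans we _; by rewrite expr2.
  have h2 := ler_wpM2l (ltW c0) le1.
  have h3 := ler_wpM2l (ltW c0) le2.
  have -> : 2^-1 * (1 + c * (K * Q)) * e = 2^-1 * (e + c * (e * (K * Q))) by ring.
  apply: le_trans h3 _; rewrite ler_pdivlMl // mulrCA; apply: le_trans h2 _.
  by rewrite mulrDr lerD2r.
rewrite complexReM complexImM /= !mul0r subr0 addr0.
have pb p := @young_complex (g (vec3 p)) (h (vec3 p)) (sobolev_weight s (vec3 p)) e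
  (K * cauchy_weight (vec3 p)) (sobolev_weight_gt0 s (vec3 p)) e0 (HK (vec3 p)).
by rewrite preimage_setT; split; apply: bound => // p; case: (pb p).
Qed.

Lemma null_pairing s f (a : X) (d : R) : sobolev_norm_space s f = 0%E ->
  cintegral setT (fun x => f x * (bump3 a d x)%:C) = 0.
Proof.
move=> f0; have [C HC] := bump3_pairing_le s f a d.
have small (x : R) : (forall e, 0 < e -> `|x| <= C * e) -> x = 0.
  move=> H; apply/eqP; rewrite -normr_le0 leNgt; apply/negP => x0.
  have C0 : 0 < `|C| + 1 by rewrite ltr_wpDl.
  (* C may be 0 or negative, whence the denominator *)
  have := H (`|x| / 2 / (`|C| + 1)) _.
  rewrite !divr_gt0 // => /(_ erefl); apply/negP; rewrite -ltNge.
  rewrite mulrA ltr_pdivrMr //.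
  apply: (@le_lt_trans _ _ (`|C| * (`|x| / 2))).
    by rewrite ler_wpM2r ?ler_norm // divr_ge0.
  have := normr_ge0 C; nra.
by apply: complex_ext; apply: small => e e0; have := HC e e0;
  rewrite f0 lte_fin => /(_ e0)[].
Qed.

(** Otherwise f would be orthogonal to a bump that lives where the real part of
    conj (f a) f is bounded below by a positive constant. *)
Lemma sobolev_norm_space_gt0 s f : ccontinuous f -> clocally_integrable f ->
  (exists x, f x <> 0) -> (0 < sobolev_norm_space s f)%E.
Proof.
move=> cf lf [a fa].
rewrite lt_neqAle sobolev_norm_space_ge0 andbT eq_sym; apply/eqP => n0.
have [m [d [m0 d0 hm]]] := local_positivity cf fa.
pose psi := bump3 a d.
have mT : measurable (vec3 @^-1` [set: X] : set R3) by rewrite preimage_setT.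
have i0 : cintegrable setT (fun x => f x * (psi x)%:C).
  apply: cintegrable_test => //; first exact: smooth_continuous (@smooth_bump3 R a d).
  exact: compactly_supported_bump3.
have [[ir _] z0] := null_integralZ (cconj (f a)) mT (conj i0 (null_pairing a d n0)).
have E : Re \o (fun x => cconj (f a) * (f x * (psi x)%:C)) \o vec3 =
    (fun p : R3 => Re (cconj (f a) * f (vec3 p)) * psi (vec3 p)).
  by apply/funext => p; rewrite /= mulrA [LHS]complexReM /= mulr0 subr0.
have ip := integrable_bump3 a d.
have I0 : \int[leb3]_p (Re (cconj (f a) * f (vec3 p)) * psi (vec3 p)) = 0.
  rewrite -[RHS]/(Re (0 : R[i])) -z0 /cintegral preimage_setT.
  by apply: eq_Rintegral => p _; rewrite -(congr1 (fun u => u p) E).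
move: I0; apply/eqP; rewrite gt_eqF //.
apply: lt_le_trans (_ : m * \int[leb3]_p psi (vec3 p) <= _).
  by rewrite mulr_gt0 // Rintegral_bump3_gt0.
rewrite -RintegralZl //; apply: le_Rintegral => //.
- exact: integrableZ_EFin.
- move: ir; rewrite preimage_setT => ir; apply: eq_integrable ir => // p _.
  by congr EFin; exact: (congr1 (fun u => u p) E).
move=> p _; have [near_a|/existsNP[i /negP]] := pselect (forall i, `|vec3 p 0 i - a 0 i| < d).
  by rewrite ler_wpM2r ?bump3_ge0 // hm.
by rewrite -leNgt => /bump3_eq0; rewrite -/psi => ->; rewrite !mulr0.
Qed.

Lemma sobolev_norm_gt0 M s f : in_sobolev M s f -> ccontinuous f ->
  (exists x, f x <> 0) -> (0 < sobolev_norm M s f)%E.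
Proof.
case: M => -[/= df lf _] cf fx; first exact: sobolev_norm_space_gt0.
exact: sobolev_norm_torus_gt0.
Qed.

(** The spectral equation turns the numerator into the norm of lambda * phi, and
    the positive finite norm of phi cancels. *)
Lemma lax_quotientE (M : domain) s (J : interval R)
    (u Omega : R -> X -> X) (lambda : R[i]) (phi : R -> X -> R[i]) t :
  lax_pair_solution M J u Omega lambda phi -> t \in J ->
  in_sobolev M s (phi t) -> (exists x, phi t x <> 0) ->
  lax_quotient M s Omega phi t = cabs lambda.
Proof.
move=> hLax tJ hS hn.
have cphi : ccontinuous (phi t).
  by split=> x; apply: differentiable_continuous;
    have [] := lax_space_regular hLax x tJ.
have n0 := sobolev_norm_gt0 hS cphi hn.
case: hS => _ lf fy.
rewrite /lax_quotient.
have -> : cadvect (Omega t) (phi t) = (fun x => lambda * phi t x).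
  by apply/funext => x; exact: lax_spectral hLax _ _ tJ.
have nf : sobolev_norm M s (phi t) \is a fin_num.
  by rewrite ge0_fin_numE // ltW.
rewrite sobolev_normZ // fineM // mulfK //.
by rewrite gt_eqF // fine_gt0 // n0.
Qed.
End LaxQuotient.

Theorem theorem3p3 (R : realType) (M : domain) (s : R) (J : interval R)
    (u Omega : R -> 'rV[R]_3 -> 'rV[R]_3)
    (lambda : R[i]%C) (phi : R -> 'rV[R]_3 -> R[i]%C)
    (hEuler : euler_vorticity_solution M J u Omega)
    (hLax : lax_pair_solution M J u Omega lambda phi)
    (hSobolev : forall t, t \in J -> in_sobolev M s (phi t))
    (hNonzero : forall t, t \in J -> exists x, phi t x <> 0) :
  forall t1 t2, t1 \in J -> t2 \in J ->
    lax_quotient M s Omega phi t1 = lax_quotient M s Omega phi t2.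
Proof.
move=> t1 t2 t1J t2J.
rewrite (lax_quotientE hLax t1J (hSobolev _ t1J) (hNonzero _ t1J)).
by rewrite (lax_quotientE hLax t2J (hSobolev _ t2J) (hNonzero _ t2J)).
Qed.
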